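(* Let $p,r$ be real numbers satisfying one of the following two conditions: (a) $1\le p<\infty$, $1\le r<\infty$ and $r\neq 2$; or (b) $1\le p<2$ and $r=2$. Then every bounded linear operator $T:L_p\to \ell_r$ is narrow.
   Context: All spaces are real. $L_p$ denotes $L_p[0,1]$ with Lebesgue measure $\mu$, and $\ell_r$ is the usual space of $r$-summable real sequences. For a Banach space $X$, a bounded linear operator $T:L_p\to X$ is called narrow if for every $\varepsilon>0$ and every Lebesgue measurable set $A\subseteq[0,1]$ there exists $x\in L_p$ with $x^2=\mathbf 1_A$ (a.e.), $\int_{[0,1]}x\,d\mu=0$ and $\|Tx\|<\varepsilon$. *)

(* Defs.v *)
From HB Require Import structures.
From mathcomp Require Import all_boot all_order all_algebra.
From mathcomp Require Import finmap.
From mathcomp Require Import all_classical all_reals all_analysis.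
From mathcomp Require Import measurable_realfun ess_sup_inf.

Set Implicit Arguments.
Unset Strict Implicit.
Unset Printing Implicit Defensive.

Import Order.TTheory GRing.Theory Num.Theory.
Import numFieldNormedType.Exports.

Local Open Scope classical_set_scope.
Local Open Scope ring_scope.

(* The library provides [LspaceType mu p1], the space of almost-everywhere
   classes of measurable functions with finite [p]-norm, as a bare type. Here it
   receives its structure of normed module: the operations are those of
   [LfunType mu p1] on representatives, the norm is [Lnorm]. An element coerces
   to one of its representatives, and two elements are equal when these agree
   almost everywhere (see [LspaceP]). *)
Section Lspace_normed.
Context d (T : measurableType d) (R : realType).
Variables (mu : {measure set T -> \bar R}) (p : \bar R) (p1 : (1 <= p)%E).
Local Notation Lsp := (LspaceType mu p1).
Local Notation Lf := (LfunType mu p1).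
Implicit Types (f g : Lf) (x y z : Lsp) (a b : R).

Lemma ae_eq_Lnorm (f g : T -> R) :
  measurable_fun setT f -> measurable_fun setT g -> f = g %[ae mu] ->
  ('N[mu]_p[EFin \o f] = 'N[mu]_p[EFin \o g])%E.
Proof.
move=> mf mg fg.
have fg' : \forall t \ae mu, (abse \o (EFin \o f)) t = (abse \o (EFin \o g)) t.
  by apply: filterS fg => t /= ->.
have mN (r : R) (h : T -> R) : measurable_fun setT h ->
    measurable_fun setT ((fun t => poweR `|(EFin \o h) t|%E r) : T -> \bar R).
  move=> mh; apply: (@measurableT_comp _ _ _ _ _ _ (@poweR R ^~ r)) => //.
    exact: measurable_poweR.
  by apply: measurableT_comp => //; apply/measurable_EFinP.
rewrite unlock /Lnorm; case: p p1 => [r r1| |//]; last first.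
  by case: ifPn => // _ _; exact: eq_ess_sup.
congr poweR; apply: ge0_ae_eq_integral => //.
- exact: mN.
- exact: mN.
- by move=> t _; exact: poweR_ge0.
- by move=> t _; exact: poweR_ge0.
- by apply: filterS fg => t /= h I; rewrite h.
Qed.

(* [R] and [measurableTypeR R] have the same measurable sets but different
   measure displays. *)
Definition mfunR_of_Lfun f : {mfun T >-> measurableTypeR R} :=
  HB.pack (f : T -> measurableTypeR R)
    (@isMeasurableFun.Build d _ T (measurableTypeR R) f
       (@measurable_funPT _ _ _ _ f)).

Definition ae_class f : {mfun_ mu, T >-> measurableTypeR R} :=
  \pi_({mfun_ mu, T >-> measurableTypeR R})%qT (mfunR_of_Lfun f).

Lemma ae_class_ae f : (ae_class f : T -> R) = f %[ae mu].
Proof.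
have : repr (ae_class f) == mfunR_of_Lfun f
    %[mod {mfun_ mu, T >-> measurableTypeR R}]%qT.
  by rewrite reprK.
by rewrite eqmodE => /asboolP.
Qed.

Lemma measurable_ae_class (u : {mfun_ mu, T >-> measurableTypeR R}) :
  measurable_fun setT (u : T -> R).
Proof.
have mu_ := @measurable_funPT _ _ _ _ (repr u).
by move=> mT Y mY; exact: (mu_ mT Y mY).
Qed.

Lemma finite_norm_ae_class f : finite_norm mu p (ae_class f).
Proof.
rewrite /finite_norm (@ae_eq_Lnorm _ f).
- exact: Lfunction_finite.
- exact: measurable_ae_class.
- exact: measurable_funPT.
- exact: ae_class_ae.
Qed.

Definition Lspace_of f : Lsp :=
  HB.pack (ae_class f)
    (@isFinLebesgue.Build _ _ _ _ _ p1 _ (finite_norm_ae_class f)).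

Lemma Lspace_Lfun x : (x : T -> R) \in Lfun mu p.
Proof.
apply/andP; split; rewrite inE/=; last exact: Lebesgue_finite.
exact: measurable_ae_class.
Qed.

Definition Lspace_repr x : Lf := Lfun_Sub p1 (Lspace_Lfun x).

Lemma Lspace_ofE f : (Lspace_of f : T -> R) = f %[ae mu].
Proof. exact: ae_class_ae. Qed.

Lemma LspaceP x y : x = y <-> (x : T -> R) = y %[ae mu].
Proof.
split=> [->|xy]; first exact: ae_eq_refl.
have exy : LebesgueSpace.sort x = LebesgueSpace.sort y.
  by rewrite -[LHS]reprK -[RHS]reprK; apply/eqP; rewrite eqmodE; apply/asboolP.
case: x y {xy} exy => [u [[cu]]] [v [[cv]]] /= uv; case: _ / uv in cv *.
by rewrite (Prop_irrelevance cu cv).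
Qed.

HB.instance Definition _ := gen_eqMixin Lsp.
HB.instance Definition _ := gen_choiceMixin Lsp.

Definition Lspace0 : Lsp := Lspace_of 0.
Definition Lspace_opp x : Lsp := Lspace_of (- Lspace_repr x).
Definition Lspace_add x y : Lsp := Lspace_of (Lspace_repr x + Lspace_repr y).
Definition Lspace_scale a x : Lsp := Lspace_of (a *: Lspace_repr x).

Lemma Lspace0E : (Lspace0 : T -> R) = cst 0 %[ae mu].
Proof. exact: Lspace_ofE. Qed.

Lemma Lspace_oppE x : (Lspace_opp x : T -> R) = (fun t => - x t) %[ae mu].
Proof. exact: Lspace_ofE. Qed.

Lemma Lspace_addE x y :
  (Lspace_add x y : T -> R) = (fun t => x t + y t) %[ae mu].
Proof. exact: Lspace_ofE. Qed.

Lemma Lspace_scaleE a x :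
  (Lspace_scale a x : T -> R) = (fun t => a * x t) %[ae mu].
Proof. exact: Lspace_ofE. Qed.

Lemma Lspace_addA : associative Lspace_add.
Proof.
move=> x y z; apply/LspaceP.
near=> t => I; rewrite (near (Lspace_addE x (Lspace_add y z)) t)//.
rewrite (near (Lspace_addE y z) t)// (near (Lspace_addE (Lspace_add x y) z) t)//.
by rewrite (near (Lspace_addE x y) t)// addrA.
Unshelve. all: by end_near. Qed.

Lemma Lspace_addC : commutative Lspace_add.
Proof.
move=> x y; apply/LspaceP; have := Lspace_addE x y; have := Lspace_addE y x.
by apply: filterS2 => t h1 h2 I; rewrite h2// h1// addrC.
Qed.

Lemma Lspace_add0 : left_id Lspace0 Lspace_add.
Proof.
move=> x; apply/LspaceP; have := Lspace_addE Lspace0 x; have := Lspace0E.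
by apply: filterS2 => t h1 h2 I; rewrite h2// h1// add0r.
Qed.

Lemma Lspace_addN : left_inverse Lspace0 Lspace_opp Lspace_add.
Proof.
move=> x; apply/LspaceP; have := Lspace_addE (Lspace_opp x) x.
have := Lspace_oppE x; have := Lspace0E.
by apply: filterS3 => t h1 h2 h3 I; rewrite h3// h2// h1// addNr.
Qed.

HB.instance Definition _ := GRing.isZmodule.Build Lsp
  Lspace_addA Lspace_addC Lspace_add0 Lspace_addN.

Lemma Lspace_scaleA a b x :
  Lspace_scale a (Lspace_scale b x) = Lspace_scale (a * b) x.
Proof.
apply/LspaceP; have := Lspace_scaleE a (Lspace_scale b x).
have := Lspace_scaleE b x; have := Lspace_scaleE (a * b) x.
by apply: filterS3 => t h1 h2 h3 I; rewrite h3// h2// h1// mulrA.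
Qed.

Lemma Lspace_scale1 : left_id 1 Lspace_scale.
Proof.
move=> x; apply/LspaceP; have := Lspace_scaleE 1 x.
by apply: filterS => t h1 I; rewrite h1// mul1r.
Qed.

Lemma Lspace_scaleDr : right_distributive Lspace_scale +%R.
Proof.
move=> a x y; apply/LspaceP; near=> t => I.
rewrite (near (Lspace_scaleE a (x + y)) t)// (near (Lspace_addE x y) t)//.
rewrite (near (Lspace_addE (Lspace_scale a x) (Lspace_scale a y)) t)//.
rewrite (near (Lspace_scaleE a x) t)// (near (Lspace_scaleE a y) t)//.
exact: mulrDr.
Unshelve. all: by end_near. Qed.

Lemma Lspace_scaleDl x :
  {morph Lspace_scale^~ x : a b / a + b}.
Proof.
move=> a b; apply/LspaceP; near=> t => I.
rewrite (near (Lspace_scaleE (a + b) x) t)//.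
rewrite (near (Lspace_addE (Lspace_scale a x) (Lspace_scale b x)) t)//.
rewrite (near (Lspace_scaleE a x) t)// (near (Lspace_scaleE b x) t)//.
exact: mulrDl.
Unshelve. all: by end_near. Qed.

HB.instance Definition _ := GRing.Zmodule_isLmodule.Build R Lsp
  Lspace_scaleA Lspace_scale1 Lspace_scaleDr Lspace_scaleDl.

Definition Lspace_norm x : R := fine ('N[mu]_p[EFin \o x])%E.

Lemma Lspace_norm_of f : Lspace_norm (Lspace_of f) = fine ('N[mu]_p[EFin \o f])%E.
Proof.
congr fine; apply: ae_eq_Lnorm => //; last exact: Lspace_ofE.
exact: measurable_ae_class.
Qed.

Lemma ler_Lspace_normD x y :
  Lspace_norm (x + y) <= Lspace_norm x + Lspace_norm y.
Proof. by rewrite [leLHS]Lspace_norm_of; exact: ler_LnormD. Qed.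

Lemma Lspace_normZ a x : Lspace_norm (a *: x) = `|a| * Lspace_norm x.
Proof.
rewrite [LHS]Lspace_norm_of; apply: EFin_inj; rewrite finite_norm_fine.
have xE : (Lspace_norm x)%:E = 'N[mu]_p[EFin \o Lspace_repr x]%E.
  exact: (finite_norm_fine (Lspace_repr x)).
by rewrite EFinM xE; exact: LnormZ.
Qed.

Lemma Lspace_norm_eq0 x : Lspace_norm x = 0 -> x = 0.
Proof.
move=> /(@fine_Lnormr_eq0 _ _ _ _ _ p1 (Lspace_repr x)) x0.
apply/LspaceP; apply: filterS2 x0 Lspace0E => t h1 h2 I.
by rewrite h2// -[RHS]h1.
Qed.

HB.instance Definition _ := Lmodule_isNormed.Build R Lsp
  ler_Lspace_normD Lspace_normZ Lspace_norm_eq0.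

End Lspace_normed.

Section ell.
Context (R : realType) (r : R) (r1 : (1 <= r%:E)%E).

(* Every real sequence is measurable for the discrete sigma-algebra on [nat],
   and only the empty set is negligible for the counting measure: [ell] is the
   type of the [r]-summable sequences themselves, see [ell_summableP] and
   [ell_normE]. *)
Definition ell : Type := LfunType (@counting nat R) r1.

HB.instance Definition _ :=
  GRing.Lmodule.copy ell (LfunType (@counting nat R) r1).

Implicit Types x y : ell.

Definition ell_norm x : R := fine ('N[@counting nat R]_(r%:E)[EFin \o x])%E.

Lemma ler_ell_normD x y : ell_norm (x + y) <= ell_norm x + ell_norm y.
Proof. exact: ler_LnormD. Qed.

Lemma ell_normZ (a : R) x : ell_norm (a *: x) = `|a| * ell_norm x.
Proof.
have xE := @finite_norm_fine _ _ _ (@counting nat R) _ r1.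
apply: EFin_inj; rewrite EFinM [LHS]xE [X in (_ * X)%E]xE; exact: LnormZ.
Qed.

Lemma counting_ae (P : nat -> Prop) :
  (\forall n \ae (@counting nat R), P n) -> forall n, P n.
Proof.
move=> [A [mA A0 PA]] n; apply: contrapT => /PA An.
move: A0; rewrite /counting; case: ifPn => // /asboolP finA [] /eqP.
rewrite pnatr_eq0 cardfs_eq0 => /eqP/fset_set_set0 A0.
by move: An; rewrite A0.
Qed.

Lemma ell_norm_eq0 x : ell_norm x = 0 -> x = 0.
Proof.
move=> /fine_Lnormr_eq0 /counting_ae x0; apply/LfuneqP => n; exact: x0.
Qed.

HB.instance Definition _ := Lmodule_isNormed.Build R ell
  ler_ell_normD ell_normZ ell_norm_eq0.

Lemma ell_normE x :
  (`|x|%:E = (\sum_(n <oo) (`|x n| `^ r)%:E) `^ r^-1)%E.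
Proof.
have r0 : 0 < r by rewrite (lt_le_trans ltr01).
rewrite [LHS](@finite_norm_fine _ _ _ (@counting nat R) _ r1 x).
by rewrite Lnorm_counting.
Qed.

Lemma ell_summableP (u : nat -> R) :
  (exists x : ell, u = x) <-> (\sum_(n <oo) (`|u n| `^ r)%:E < +oo)%E.
Proof.
have r0 : 0 < r by rewrite (lt_le_trans ltr01).
have S0 : (0 <= \sum_(n <oo) (`|u n| `^ r)%:E)%E.
  by apply: nneseries_ge0 => n _ _; rewrite lee_fin powR_ge0.
split=> [[x ux]|uoo].
  have := @Lfunction_finite _ _ _ _ _ r1 (x : LfunType (@counting nat R) r1).
  rewrite /finite_norm -ux Lnorm_counting//.
  by apply: lty_poweRy; rewrite invr_neq0// gt_eqF.
have mu_ : u \in Lfun (@counting nat R) r%:E.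
  apply/andP; split; rewrite inE//= /finite_norm Lnorm_counting//.
  exact: poweR_lty.
by exists (Lfun_Sub r1 mu_).
Qed.

End ell.

(* [R] with the Lebesgue-measurable sets, the domain of the library's
   [completed_lebesgue_measure]. *)
Definition lebesgue_type (R : realType) : Type :=
  caratheodory_type (R := R) (T := ocitv_type R) (wlength idfun)^*%mu.
HB.instance Definition _ (R : realType) := Measurable.on (lebesgue_type R).

Lemma lebesgue_measurable_itv01 (R : realType) :
  measurable (`[0, 1]%classic : set (lebesgue_type R)).
Proof.
apply: sub_caratheodory; exact: (measurable_itv (`[0, 1] : interval R)).
Qed.

(* Lebesgue measure on [0, 1], carried by [R]: functions are considered up to
   equality almost everywhere on [0, 1], so that [LspaceType (mu01 R) p1] is
   L_p[0, 1] whatever the values outside of the interval. *)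
Definition mu01 (R : realType) : set (lebesgue_type R) -> \bar R :=
  mrestr (@completed_lebesgue_measure R) (@lebesgue_measurable_itv01 R).
Arguments mu01 R : clear implicits.
HB.instance Definition _ (R : realType) := Measure.on (mu01 R).

Lemma mu01T (R : realType) : mu01 R setT = 1%E.
Proof.
rewrite /mu01 /mrestr setTI.
have := @lebesgue_measure_itv R `[0, 1]; rewrite /= lte_fin ltr01 oppr0 adde0.
exact.
Qed.

Definition narrow (R : realType) (p : \bar R) (p1 : (1 <= p)%E)
    (X : normedModType R) (T : LspaceType (mu01 R) p1 -> X) : Prop :=
  forall (eps : R) (A : set (lebesgue_type R)), 0 < eps ->
    measurable A -> A `<=` `[0, 1] ->
    exists x : LspaceType (mu01 R) p1,
      [/\ (fun t => x t ^+ 2) = \1_A %[ae mu01 R],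
          (\int[mu01 R]_t (x t)%:E = 0)%E
        & `|T x| < eps].

(* Main.v *)
Require Import Defs.
From mathcomp Require Import all_boot all_order all_algebra.
From mathcomp Require Import all_classical all_reals all_analysis.
From mathcomp Require Import measurable_realfun ring lra.

Set Implicit Arguments.
Unset Strict Implicit.
Unset Printing Implicit Defensive.

Import Order.TTheory GRing.Theory Num.Theory.
Import numFieldNormedType.Exports.

Local Open Scope classical_set_scope.
Local Open Scope ring_scope.

(** Call a function a sign on A when its square is the indicator of A, and
balanced when moreover its integral is zero; a balanced sign s on A with
|T s| < eps is wanted. Write S f for T applied to the class of a bounded
measurable function f.

Two facts carry the proof. First, finitely many bounded functionals on L_p are
simultaneously small on some balanced sign on A ([balanced_small]): on a set
of small measure a functional is small on every sign, and signs on disjoint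
pieces can be added with coefficients 1 or -1 so that the values of the last
functional never accumulate, while induction takes care of the other ones.
Secondly, if x is a fixed vector of l_r and y is a bounded vector whose first
coordinates are tiny, then |x + y|^r is close to |x|^r + |y|^r
([ell_almost_disjoint]). Hence, whatever the vector x already built and the
bounded weight g, there is a balanced sign s on A for which
|x + S (g s)|^r is nearly |x|^r + |S (g s)|^r ([almost_disjoint_sign]).

When p < r, which covers r = 2, cut A into n pieces of measure at most 1/n and
add signs on the pieces one at a time. This gives a balanced sign s with
|S s|^r of order n (n^(-1/p))^r, which tends to zero ([small_sign_lt]).

When r <> 2, the signs are the steps of a simple random walk on A: its step is
1/n, it starts at 0 and it stops on reaching 1 or -1 ([stopped_walk]). After k
steps f^2 has integral about n^(-2) times the sum of the measures of the sets
C_j where the walk still runs at time j, and |S f|^r is about the sum of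
|S (n^(-1) 1_(C_j) s_j)|^r, where s_j is the j-th sign.

If r > 2, take k = K n^2. As f^2 <= 1, the walk still runs only on a set of
measure about 1/K, so that up to a small correction f is a balanced sign,
whereas |S f|^r is at most of order K n^(2 - r), which tends to zero
([small_sign_gt2]).

If r < 2, suppose that |S s| >= eps for all balanced signs on A. Take k to be a
small multiple of n^2: the integral of f^2 is then small, so the walk still
runs on most of A throughout, and every term of the sum is at least about
(eps / 2n)^r. Then |S f|^r is at least of order k n^(-r), which is unbounded
although |f| <= 1 ([small_sign_lt2]). *)

(** * Bounded measurable functions and signs *)

Section bounded_measurable.
Context d (T : measurableType d) (R : realType).
Implicit Types (f g s : T -> R) (A B : set T) (c : R).

Lemma indic_ge0 A t : 0 <= \1_A t :> R.
Proof. by rewrite indicE. Qed.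

Lemma indic_le1 A t : \1_A t <= 1 :> R.
Proof. by rewrite indicE; case: (_ \in _). Qed.

Definition bmeas f := measurable_fun setT f /\ exists c, forall t, `|f t| <= c.

Lemma bmeasD f g : bmeas f -> bmeas g -> bmeas (f + g).
Proof.
move=> [mf [a fa]] [mg [b gb]]; split; first exact: measurable_funD.
exists (a + b) => t; rewrite fctE (le_trans (ler_normD _ _))//.
exact: lerD.
Qed.

Lemma bmeasM f g : bmeas f -> bmeas g -> bmeas (f * g).
Proof.
move=> [mf [a fa]] [mg [b gb]]; split; first exact: measurable_funM.
by exists (a * b) => t; rewrite fctE normrM ler_pM.
Qed.

Lemma bmeas_cst c : bmeas (cst c).
Proof. by split; [exact: measurable_cst|exists `|c|]. Qed.

Lemma bmeasZ c f : bmeas f -> bmeas (c *: f).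
Proof. by move=> bf; exact: (bmeasM (bmeas_cst c) bf). Qed.

Lemma bmeasN f : bmeas f -> bmeas (- f).
Proof. by move=> bf; rewrite -scaleN1r; exact: bmeasZ. Qed.

Lemma bmeasB f g : bmeas f -> bmeas g -> bmeas (f - g).
Proof. by move=> bf bg; apply: bmeasD => //; exact: bmeasN. Qed.

Lemma bmeas_indic A : measurable A -> bmeas \1_A.
Proof.
move=> mA; split; first exact: measurable_indic.
by exists 1 => t; rewrite indicE; case: (_ \in _); rewrite ?normr1 ?normr0.
Qed.

Definition issign A s := measurable_fun setT s /\ forall t, s t ^+ 2 = \1_A t.

Lemma issign_norm A s t : issign A s -> `|s t| = \1_A t.
Proof.
move=> [_ /(_ t)]; rewrite indicE; case: (_ \in _) => /= h.
  by apply/eqP; rewrite -(@eqrXn2 _ 2)// expr1n real_normK ?num_real// h.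
by move/eqP: h; rewrite expf_eq0 /= => /eqP ->; rewrite normr0.
Qed.

Lemma issign_bmeas A s : issign A s -> bmeas s.
Proof.
move=> sA; split; first by case: sA.
exists 1 => t; rewrite (issign_norm t sA) indicE.
by case: (_ \in _).
Qed.

Lemma issignN A s : issign A s -> issign A (- s).
Proof.
move=> sA; split; first by case: (bmeasN (issign_bmeas sA)).
by move=> t; rewrite fctE sqrrN; case: sA.
Qed.

Lemma issign_eq0 A s t : issign A s -> ~ A t -> s t = 0.
Proof.
move=> sA At; apply/eqP; rewrite -normr_eq0 (issign_norm t sA) indicE.
by rewrite memNset.
Qed.

Lemma issignU A B s u : A `&` B = set0 -> issign A s -> issign B u ->
  issign (A `|` B) (s + u).
Proof.
move=> AB sA uB; split.
  by case: (bmeasD (issign_bmeas sA) (issign_bmeas uB)).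
move=> t; rewrite fctE indicE in_setU.
have [At|At] := pselect (A t).
  have Bt : ~ B t by move=> Bt; have : (A `&` B) t by []; rewrite AB.
  rewrite (issign_eq0 uB Bt) addr0 (mem_set At) /=.
  by case: sA => _ ->; rewrite indicE mem_set.
rewrite (issign_eq0 sA At) add0r (memNset At) /=.
by case: uB => _ ->; rewrite indicE.
Qed.

Lemma issign_indicB A B : measurable A -> measurable B -> B `<=` A ->
  issign A (\1_B - \1_(A `\` B)).
Proof.
move=> mA mB BA; split.
  have mAB : measurable (A `\` B) by exact: measurableD.
  by case: (bmeasB (bmeas_indic mB) (bmeas_indic mAB)).
move=> t; rewrite !fctE !indicE in_setD.
have [Bt|Bt] := pselect (B t).
  by rewrite (mem_set Bt) (mem_set (BA _ Bt)) /= subr0 expr1n.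
by rewrite (memNset Bt) /= andbT sub0r sqrrN; case: (_ \in _); rewrite ?expr1n ?expr0n.
Qed.

End bounded_measurable.
Arguments indic_ge0 {d T R}.
Arguments indic_le1 {d T R}.

(** * Integration of bounded functions against a probability measure *)

Section probability.
Context d (T : measurableType d) (R : realType).
Variable mu : {measure set T -> \bar R}.
Hypothesis mu1 : mu setT = 1%E.
Implicit Types (f g s : T -> R) (A B : set T) (c : R).

Definition mass A : R := fine (mu A).
Definition integ f : R := \int[mu]_t f t.

Lemma mass_fin A : measurable A -> mu A \is a fin_num.
Proof.
move=> mA; rewrite ge0_fin_numE//.
have : (mu A <= mu setT)%E by apply: le_measure => //; rewrite inE.
by rewrite mu1 => /le_lt_trans; apply; rewrite ltry.
Qed.

Lemma massE A : measurable A -> (mass A)%:E = mu A.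
Proof. by move=> mA; rewrite fineK// mass_fin. Qed.

Lemma mass_ge0 A : 0 <= mass A.
Proof. exact: fine_ge0. Qed.

Lemma le_mass A B : measurable A -> measurable B -> A `<=` B ->
  mass A <= mass B.
Proof.
move=> mA mB AB; rewrite -lee_fin !massE//.
by apply: le_measure => //; rewrite inE.
Qed.

Lemma mass_le1 A : measurable A -> mass A <= 1.
Proof.
move=> mA; have -> : 1 = mass setT by rewrite /mass mu1.
exact: le_mass.
Qed.

Lemma massD A B : measurable A -> measurable B -> B `<=` A ->
  mass A = mass B + mass (A `\` B).
Proof.
move=> mA mB BA; apply: EFin_inj; rewrite EFinD !massE//; last exact: measurableD.
rewrite -measureU//; [|exact: measurableD|by rewrite setDIK].
by rewrite setDUK.
Qed.

Lemma bmeas_integrable f : bmeas f -> mu.-integrable setT (EFin \o f).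
Proof.
move=> [mf [c fc]]; apply: measurable_bounded_integrable => //.
  by rewrite mu1 ltry.
exists c; split; first exact: num_real.
by move=> x cx t _ /=; rewrite (le_trans (fc t))// ltW.
Qed.

Lemma integD f g : bmeas f -> bmeas g -> integ (f + g) = integ f + integ g.
Proof. by move=> bf bg; exact: RintegralD (bmeas_integrable _) (bmeas_integrable _). Qed.

Lemma integZ c f : bmeas f -> integ (c *: f) = c * integ f.
Proof. by move=> bf; exact: RintegralZl (bmeas_integrable _). Qed.

Lemma integN f : bmeas f -> integ (- f) = - integ f.
Proof. by move=> bf; rewrite -scaleN1r integZ// mulN1r. Qed.

Lemma integ_indic A : measurable A -> integ \1_A = mass A.
Proof. by move=> mA; rewrite /integ /Rintegral integral_indic// setIT. Qed.

Lemma le_integ f g : bmeas f -> bmeas g -> (forall t, f t <= g t) -> integ f <= integ g.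
Proof. by move=> bf bg fg; apply: le_Rintegral => //; exact: bmeas_integrable. Qed.

Lemma integ_norm_le A c f : measurable A -> bmeas f -> (forall t, `|f t| <= c * \1_A t) ->
  `|integ f| <= c * mass A.
Proof.
move=> mA bf fA; rewrite -integ_indic// -integZ; last exact: bmeas_indic.
have bA := bmeasZ c (bmeas_indic R mA).
rewrite ler_norml -integN//; apply/andP; split; apply: le_integ => //; first exact: bmeasN.
  by move=> t; have := fA t; rewrite ler_norml => /andP[].
by move=> t; have := fA t; rewrite ler_norml => /andP[].
Qed.

(** * Balanced signs that are small for finitely many functionals *)

Hypothesis split_measure : forall A c, measurable A -> 0 <= c <= mass A ->
  exists B, [/\ measurable B, B `<=` A & mass B = c].

Definition balanced A s := issign A s /\ integ s = 0.

Lemma balancedN A s : balanced A s -> balanced A (- s).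
Proof.
move=> [sA s0]; split; first exact: issignN.
by rewrite integN ?s0 ?oppr0//; exact: issign_bmeas sA.
Qed.

Lemma balancedU A B s u : A `&` B = set0 -> balanced A s -> balanced B u ->
  balanced (A `|` B) (s + u).
Proof.
move=> AB [sA s0] [uB u0]; split; first exact: issignU.
by rewrite integD ?s0 ?u0 ?addr0//; [exact: issign_bmeas sA|exact: issign_bmeas uB].
Qed.

Lemma balanced_exists A : measurable A -> exists s, balanced A s.
Proof.
move=> mA; have [|B [mB BA hB]] := split_measure (c := mass A / 2) mA.
  by have := mass_ge0 A; lra.
exists (\1_B - \1_(A `\` B)); split; first exact: issign_indicB.
have mAB : measurable (A `\` B) by exact: measurableD.
rewrite integD ?integN ?integ_indic//; try exact: bmeas_indic.
  by have := massD mA mB BA; rewrite hB; lra.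
exact/bmeasN/bmeas_indic.
Qed.

(** The continuity that the argument needs: smallness on the functions carried
by a set of small measure and bounded there by 1. The integral has it, and so
does every bounded operator on L_p for p finite. It passes from phi to its
coordinates and to [fun f => phi (g * f)] for any bounded g, which puts all
the functionals of the random walk in one family. *)
Definition ac_linear (V : normedModType R) (phi : (T -> R) -> V) :=
  [/\ forall f g, bmeas f -> bmeas g -> phi (f + g) = phi f + phi g,
      forall c f, bmeas f -> phi (c *: f) = c *: phi f
    & forall e, 0 < e -> exists2 h, 0 < h & forall A f, measurable A -> bmeas f ->
      (forall t, `|f t| <= \1_A t) -> mass A <= h -> `|phi f| <= e].

Lemma ac_linearN (V : normedModType R) (phi : (T -> R) -> V) f :
  ac_linear phi -> bmeas f -> phi (- f) = - phi f.
Proof. by move=> [_ pZ _] bf; rewrite -scaleN1r pZ// scaleN1r. Qed.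

Lemma issign_le A s : issign A s -> forall t, `|s t| <= \1_A t.
Proof. by move=> sA t; rewrite (issign_norm t sA). Qed.

Lemma ler_normDB (a b e : R) : `|a| <= e -> `|b| <= e ->
  `|a + b| <= e \/ `|a - b| <= e.
Proof.
rewrite !ler_norml => /andP[? ?] /andP[? ?].
have [?|?] := leP 0 a; have [?|?] := leP 0 b.
- by right; apply/andP; split; lra.
- by left; apply/andP; split; lra.
- by left; apply/andP; split; lra.
- by right; apply/andP; split; lra.
Qed.

(** Induction on the number n of functionals. The set is cut into pieces so
small that the last functional is at most e on any sign carried by a piece. By
induction each piece carries a balanced sign on which the other functionals
are as small as desired; when it is joined to the sum of the previous ones,
one of the two choices of its orientation keeps the value of the last
functional within [-e, e]. *)
Lemma balanced_small n (phi : nat -> (T -> R) -> R) :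
  (forall i, (i < n)%N -> ac_linear (phi i)) ->
  forall A e, measurable A -> 0 < e ->
  exists2 s, balanced A s & forall i, (i < n)%N -> `|phi i s| <= e.
Proof.
elim: n => [_ A e mA e0|n IH aphi A e mA e0].
  by have [s sA] := balanced_exists mA; exists s.
have {}IH := IH (fun i hi => aphi i (ltnW hi)).
have [pD pZ pac] := aphi n (ltnSn n).
have [h h0 hn] := pac e e0.
have pieces k : forall B e', measurable B -> mass B <= k%:R * h -> 0 < e' ->
    exists s, [/\ balanced B s, forall i, (i < n)%N -> `|phi i s| <= e'
      & `|phi n s| <= e].
  elim: k => [|k IHk] B e' mB Bk e'0.
    have [s bs ss] := IH B e' mB e'0; exists s; split => //.
    apply: (hn B) => //; first exact: issign_bmeas (proj1 bs).
      exact: issign_le (proj1 bs).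
    by rewrite (le_trans Bk)// mul0r ltW.
  have [Bh|hB] := leP (mass B) h.
    have [s bs ss] := IH B e' mB e'0; exists s; split => //.
    apply: (hn B) => //; first exact: issign_bmeas (proj1 bs).
    exact: issign_le (proj1 bs).
  (* a piece C of measure h is split off; the rest is handled by induction *)
  have [|C [mC CB hC]] := split_measure (c := h) mB; first by rewrite !ltW.
  have mBC : measurable (B `\` C) by exact: measurableD.
  have e'2 : 0 < e' / 2 by rewrite divr_gt0.
  have [|s [bs ss sn]] := IHk (B `\` C) (e' / 2) mBC _ e'2.
    by have := massD mB mC CB; rewrite hC; move: Bk; rewrite -natr1 mulrDl; lra.
  have [u bu uu] := IH C (e' / 2) mC e'2.
  have un : `|phi n u| <= e.
    apply: (hn C) => //; [exact: issign_bmeas (proj1 bu)| |by rewrite hC].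
    exact: issign_le (proj1 bu).
  have bms := issign_bmeas (proj1 bs).
  have bmu := issign_bmeas (proj1 bu).
  have BE : B = (B `\` C) `|` C by rewrite setUC setDUK.
  have BC0 : (B `\` C) `&` C = set0 by rewrite setIC setDIK.
  have [sun|sun] := ler_normDB sn un.
    exists (s + u); split; first by rewrite BE; exact: balancedU.
      move=> i i_n; have [piD _ _] := aphi i (ltnW i_n).
      rewrite piD// (le_trans (ler_normD _ _))//.
      by have := ss i i_n; have := uu i i_n; lra.
    by rewrite pD.
  exists (s - u); split.
  - by rewrite BE; apply: balancedU => //; exact: balancedN.
  - move=> i i_n; have [piD _ _] := aphi i (ltnW i_n).
    rewrite piD//; last exact: bmeasN.
    rewrite (ac_linearN (aphi i (ltnW i_n)))// (le_trans (ler_normB _ _))//.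
    by have := ss i i_n; have := uu i i_n; lra.
  - by rewrite pD ?(ac_linearN (aphi n _))//; exact: bmeasN.
have [|s [bs ss sn]] := pieces (Num.truncn h^-1).+1 A e mA _ e0.
  rewrite (le_trans (mass_le1 mA))// -ler_pdivrMr// div1r.
  by rewrite ltW// truncnS_gt.
exists s => // i; rewrite ltnS leq_eqVlt => /orP[/eqP ->//|]; exact: ss.
Qed.

End probability.

(** * Almost disjoint vectors of l_r *)

Section power_function.
Context (R : realType) (r : R).
Hypothesis r1 : 1 <= r.
Implicit Types a b e C : R.

Let r0 : 0 <= r. Proof. exact: le_trans r1. Qed.

(** Convexity of the power between b and b + 1. *)
Lemma powR_addl_le b e : 0 <= b -> 0 <= e <= 1 ->
  (b + e) `^ r <= b `^ r + e * (b + 1) `^ r.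
Proof.
move=> b0 /andP[e0 e1].
have h : (e * (b + 1) + (1 - e) * b) `^ r
    <= e * (b + 1) `^ r + (1 - e) * b `^ r.
  by apply: (convex_powR r1 (Itv01 e0 e1));
    rewrite inE/= in_itv/= andbT// addr_ge0.
have -> : b + e = e * (b + 1) + (1 - e) * b by ring.
apply: (le_trans h); rewrite addrC lerD2r.
by rewrite ler_piMl ?powR_ge0//; lra.
Qed.

Lemma powR_le_mono a b : 0 <= a -> a <= b -> a `^ r <= b `^ r.
Proof.
by move=> a0 ab; apply: ge0_ler_powR; rewrite ?nnegrE// (le_trans a0).
Qed.

Lemma powR_le_cancel a b : 0 <= b -> a `^ r <= b `^ r -> a <= b.
Proof.
move=> b0 ab; rewrite leNgt; apply/negP => ba.
have a0 : 0 <= a by rewrite (le_trans b0)// ltW.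
have := gt0_ltr_powR (lt_le_trans ltr01 r1) b0 a0 ba.
by rewrite ltNge ab.
Qed.

Lemma powR_dist_le C a b e : 0 <= a <= C -> 0 <= b <= C -> 0 <= e <= 1 ->
  `|a - b| <= e -> `|a `^ r - b `^ r| <= e * (C + 1) `^ r.
Proof.
move=> /andP[a0 aC] /andP[b0 bC] e01; have /andP[e0 e1] := e01.
have bnd x y : 0 <= x <= C -> 0 <= y -> y <= x + e ->
    y `^ r <= x `^ r + e * (C + 1) `^ r.
  move=> /andP[x0 xC] y0 yx; rewrite (le_trans (powR_le_mono y0 yx))//.
  rewrite (le_trans (powR_addl_le x0 e01))// lerD2l ler_wpM2l//.
  by apply: powR_le_mono; lra.
rewrite !ler_norml => /andP[h1 h2]; apply/andP; split.
  have := bnd a b; rewrite a0 aC => /(_ isT b0); lra.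
have := bnd b a; rewrite b0 bC => /(_ isT a0); lra.
Qed.
End power_function.

Section ell_geometry.
Context (R : realType) (r : R) (r1 : (1 <= r%:E)%E).
Local Notation X := (ell r1).
Implicit Types x y z : X.

Let r1' : 1 <= r. Proof. by rewrite -lee_fin. Qed.
Let r0 : r != 0. Proof. by rewrite gt_eqF// (lt_le_trans ltr01). Qed.

Lemma ell_addE x y i : (x + y) i = x i + y i. Proof. by []. Qed.
Lemma ell_oppE x i : (- x) i = - x i. Proof. by []. Qed.

Lemma ell_powE x : ((`|x| `^ r)%:E = \sum_(i <oo) (`|x i| `^ r)%:E)%E.
Proof.
rewrite -poweR_EFin ell_normE -poweRrM mulVf// poweRe1//.
by apply: nneseries_ge0 => n _ _; rewrite lee_fin powR_ge0.
Qed.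

Lemma ell_coord_le x i : `|x i| <= `|x|.
Proof.
apply: (powR_le_cancel r1') => //; rewrite -lee_fin ell_powE.
apply: le_trans (nneseries_lim_ge i.+1 _) => /=.
  by rewrite big_mkord big_ord_recr/= leeDr// sume_ge0// => j _; rewrite lee_fin powR_ge0.
by move=> j _ _; rewrite lee_fin powR_ge0.
Qed.

Lemma ell_restrict x (P : pred nat) :
  exists y : X, forall i, y i = if P i then x i else 0.
Proof.
pose u i := if P i then x i else 0.
have /ell_summableP : (\sum_(i <oo) (`|u i| `^ r)%:E < +oo)%E.
  apply: (@le_lt_trans _ _ (\sum_(i <oo) (`|x i| `^ r)%:E)%E); last first.
    by rewrite -ell_powE ltry.
  apply: lee_nneseries => i _; first by rewrite lee_fin powR_ge0.
  rewrite lee_fin /u; case: (P i) => //.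
  by rewrite normr0 powR0// powR_ge0.
by move=> /(_ r1) [y yE]; exists y => i; rewrite -yE.
Qed.

Lemma ell_disjointD y z : (forall i, y i = 0 \/ z i = 0) ->
  `|y + z| `^ r = `|y| `^ r + `|z| `^ r.
Proof.
move=> yz; apply: EFin_inj; rewrite EFinD !ell_powE -nneseriesD//.
apply: eq_eseriesr => i _; rewrite -EFinD ell_addE.
by have [->|->] := yz i; rewrite ?add0r ?addr0 normr0 powR0// ?add0r ?addr0.
Qed.

Lemma ell_tail x (e : R) : 0 < e -> exists n, forall z,
  (forall i, z i = if (i < n)%N then 0 else x i) -> `|z| <= e.
Proof.
move=> e0; pose f i := (`|x i| `^ r)%:E.
have f0 i : (0 <= f i)%E by rewrite lee_fin powR_ge0.
have : (\sum_(N <= i <oo) f i @[N --> \oo] --> 0)%E.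
  by apply: nneseries_tail_cvg => //; rewrite -ell_powE ltry.
move=> /fine_cvgP[_] /cvgrPdist_le /(_ _ (powR_gt0 r e0)) [n _ /(_ n (leqnn n))] h.
exists n => z zE; apply: (powR_le_cancel r1'); first exact: ltW.
rewrite -lee_fin ell_powE (nneseries_split 0 n)/=; last first.
  by move=> *; rewrite lee_fin powR_ge0.
rewrite add0n big_nat big1 ?add0e; last first.
  by move=> i /andP[_ i_n]; rewrite zE i_n normr0 powR0.
apply: (@le_trans _ _ (\sum_(n <= i <oo) f i)%E).
  apply: lee_nneseries => i _; first by rewrite lee_fin powR_ge0.
  by rewrite lee_fin powR_le_mono// zE; case: ifP; rewrite ?normr0.
have fin : (\sum_(n <= i <oo) f i)%E \is a fin_num.
  rewrite ge0_fin_numE; last by apply: nneseries_ge0.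
  apply: (@le_lt_trans _ _ (\sum_(i <oo) f i)%E); last by rewrite -ell_powE ltry.
  rewrite (nneseries_split 0 n)//= leeDr// sume_ge0//.
rewrite -(fineK fin) lee_fin; move: h; rewrite sub0r normrN; apply: le_trans.
exact: ler_norm.
Qed.

(** The weight [n.+1] works for every exponent r >= 1, because
n * (n + 1)^(-r) <= 1. *)
Lemma ell_head (e : R) n y : 0 < e -> (forall i, (i < n)%N -> `|y i| <= e / n.+1%:R) ->
  (forall i, (n <= i)%N -> y i = 0) -> `|y| <= e.
Proof.
move=> e0 yh yt; apply: (powR_le_cancel r1'); first exact: ltW.
rewrite -lee_fin ell_powE (nneseries_split 0 n)/=; last first.
  by move=> *; rewrite lee_fin powR_ge0.
rewrite add0n [X in (_ + X)%E]eseries0 ?adde0; last first.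
  by move=> i /= ni _; rewrite yt// normr0 powR0.
apply: (@le_trans _ _ (\sum_(0 <= i < n) ((e / n.+1%:R) `^ r)%:E)%E).
  rewrite !big_nat; apply: lee_sum => i /andP[_ i_n]; rewrite lee_fin.
  by apply: (powR_le_mono r1') => //; exact: yh.
rewrite sumEFin lee_fin sumr_const_nat subn0 powRM ?invr_ge0//; last exact: ltW.
rewrite -[X in X <= _]mulr_natr -mulrA ler_piMr ?powR_ge0//.
rewrite -(@powR_inv1 _ n.+1%:R)// -powRrM mulN1r powRN mulrC ler_pdivrMr ?powR_gt0// mul1r.
by rewrite (@le_trans _ _ n.+1%:R) ?ler_nat// le1r_powR// ler1n.
Qed.

(** Let n be such that the tail of x from n on is negligible. If the first n
coordinates of y are negligible as well, x and y are small perturbations of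
vectors with disjoint supports, for which the identity is exact; and the r-th
power is uniformly continuous on bounded sets. *)
Lemma ell_almost_disjoint x (B e : R) : 0 < e ->
  exists n, exists2 h : R, 0 < h & forall y, `|y| <= B ->
    (forall i, (i < n)%N -> `|y i| <= h) ->
    `| `|x + y| `^ r - `|x| `^ r - `|y| `^ r| <= e.
Proof.
move=> e0; have [B0|B0] := ltP B 0.
  by exists 0%N, 1 => // y yB; have := le_lt_trans yB B0; rewrite normr_lt0.
pose C := `|x| + B; pose L := (C + 1) `^ r.
have C0 : 0 <= C by rewrite addr_ge0.
have L1 : 1 <= L.
  have -> : 1 = 1 `^ r :> R by rewrite powR1.
  by apply: (powR_le_mono r1') => //; lra.
have L0 : 0 < L by lra.
pose k := Num.min (2^-1) (e / (4 * L)).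
have k0 : 0 < k by rewrite lt_min invr_gt0 ltr0n/= divr_gt0// mulr_gt0.
have k2 : k <= 2^-1 by rewrite ge_min lexx.
have ke : 4 * (k * L) <= e.
  by rewrite mulrCA -ler_pdivlMr ?mulr_gt0// ge_min lexx orbT.
have [n tail] := ell_tail x k0.
exists n, (k / n.+1%:R); first by rewrite divr_gt0.
move=> y yB yh.
have [x1 x1E] := ell_restrict x (fun i => (i < n)%N).
have [x2 x2E] := ell_restrict x (fun i => ~~ (i < n)%N).
have [y1 y1E] := ell_restrict y (fun i => (i < n)%N).
have [y2 y2E] := ell_restrict y (fun i => ~~ (i < n)%N).
(* x1 + y2 is the disjoint pair; x2 and y1 are the negligible parts *)
have xx : x = x1 + x2.
  by apply/LfuneqP => i; rewrite ell_addE x1E x2E; case: ltnP; rewrite ?addr0 ?add0r.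
have yy : y = y1 + y2.
  by apply/LfuneqP => i; rewrite ell_addE y1E y2E; case: ltnP; rewrite ?addr0 ?add0r.
have x2k : `|x2| <= k by apply: tail => i; rewrite x2E; case: ltnP.
have y1k : `|y1| <= k.
  apply: (@ell_head k n) => // [i i_n|i ni]; first by rewrite y1E i_n yh.
  by rewrite y1E ltnNge ni.
have powx : `|x| `^ r = `|x1| `^ r + `|x2| `^ r.
  by rewrite {1}xx ell_disjointD// => i; rewrite x1E x2E; case: ltnP; [right|left].
have powy : `|y| `^ r = `|y1| `^ r + `|y2| `^ r.
  by rewrite {1}yy ell_disjointD// => i; rewrite y1E y2E; case: ltnP; [right|left].
have powxy : `|x1 + y2| `^ r = `|x1| `^ r + `|y2| `^ r.
  by apply: ell_disjointD => i; rewrite x1E y2E; case: ltnP; [right|left].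
have x1x : `|x1| <= `|x|.
  by apply: (powR_le_cancel r1') => //; rewrite powx lerDl powR_ge0.
have y2y : `|y2| <= `|y|.
  by apply: (powR_le_cancel r1') => //; rewrite powy lerDr powR_ge0.
have dxy : `| `|x + y| `^ r - `|x1 + y2| `^ r| <= (2 * k) * L.
  apply: (powR_dist_le r1').
  - by rewrite normr_ge0 (le_trans (ler_normD _ _))// lerD2l.
  - by rewrite normr_ge0 (le_trans (ler_normD _ _))// lerD// (le_trans y2y).
  - by apply/andP; split; lra.
  - rewrite (le_trans (ler_dist_dist _ _))// xx yy.
    have -> : x1 + x2 + (y1 + y2) - (x1 + y2) = x2 + y1.
      by rewrite addrACA opprD addrA addrAC; apply/LfuneqP => i; rewrite !(ell_addE, ell_oppE); ring.
    by rewrite (le_trans (ler_normD _ _))//; lra.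
have dx : `| `|x| `^ r - `|x1| `^ r| <= k * L.
  apply: (powR_dist_le r1'); rewrite ?normr_ge0/= ?lerDl//.
  - by rewrite (le_trans x1x)// lerDl.
  - by apply/andP; split; lra.
  - by rewrite (le_trans (ler_dist_dist _ _))// xx addrAC subrr add0r.
have dy : `| `|y| `^ r - `|y2| `^ r| <= k * L.
  apply: (powR_dist_le r1'); rewrite ?normr_ge0/=.
  - by rewrite (le_trans yB)// lerDr.
  - by rewrite (le_trans y2y)// (le_trans yB)// lerDr.
  - by apply/andP; split; lra.
  - by rewrite (le_trans (ler_dist_dist _ _))// yy addrK.
move: dxy dx dy; rewrite powxy !ler_norml.
by move=> /andP[? ?] /andP[? ?] /andP[? ?]; apply/andP; split; lra.
Qed.
End ell_geometry.

(** * Small signs for operators into l_r *)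

Section small_signs.
Context d (T : measurableType d) (R : realType).
Variable mu : {measure set T -> \bar R}.
Hypothesis mu1 : mu setT = 1%E.
Implicit Types (f g s : T -> R) (A B C D : set T) (c e : R).

Lemma integ_ac : ac_linear mu (integ mu : _ -> R).
Proof.
split; [exact: integD|by move=> c f bf; exact: integZ|].
move=> e e0; exists e => // A f mA bf fA Ae.
by rewrite (le_trans _ Ae)// -[leRHS]mul1r integ_norm_le// => t; rewrite mul1r.
Qed.

Lemma ac_linear_mul (V : normedModType R) (phi : (T -> R) -> V) g :
  ac_linear mu phi -> bmeas g -> ac_linear mu (fun f => phi (g * f)).
Proof.
move=> [pD pZ pac] bg; split.
- by move=> f1 f2 b1 b2; rewrite mulrDr pD//; exact: bmeasM.
- move=> c f bf; rewrite -pZ; last exact: bmeasM.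
  by congr phi; apply/funext => t; rewrite !fctE/= /GRing.scale/= mulrCA.
move=> e e0; have [_ [b gb]] := bg.
pose c := Num.max b 1; have c0 : 0 < c by rewrite lt_max ltr01 orbT.
have gc t : `|g t| <= c by rewrite (le_trans (gb t))// le_max lexx.
have [h h0 hp] := pac _ (divr_gt0 e0 c0); exists h => // A f mA bf fA Ah.
have -> : g * f = c *: (c^-1 *: (g * f)) by rewrite scalerA divff ?gt_eqF// scale1r.
have bgf := bmeasM bg bf.
rewrite pZ; last exact: bmeasZ.
rewrite normrZ gtr0_norm// mulrC -ler_pdivlMr//; apply: (hp A) => //; first exact: bmeasZ.
move=> t; rewrite !fctE /= normrM gtr0_norm ?invr_gt0// normrM.
rewrite mulrC ler_pdivrMr// mulrC; apply: ler_pM => //.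
Qed.

Lemma ac_linear_coord (r : R) (r1 : (1 <= r%:E)%E) (S : (T -> R) -> ell r1) i :
  ac_linear mu S -> ac_linear mu (fun f => S f i : R).
Proof.
move=> [SD SZ Sac]; split.
- by move=> f g bf bg; rewrite SD.
- by move=> c f bf; rewrite SZ.
move=> e /Sac[h h0 hS]; exists h => // A f mA bf fA Ah.
exact: le_trans (ell_coord_le _ _) (hS A f mA bf fA Ah).
Qed.

Hypothesis split_measure : forall A c, measurable A -> 0 <= c <= mass mu A ->
  exists B, [/\ measurable B, B `<=` A & mass mu B = c].

(** If the integral of s is c >= 0, then s = 1 on a set of measure at least c,
and changing s into -1 on a part of it of measure c / 2 makes the integral
vanish. *)
Lemma balance_sign A s : measurable A -> issign A s ->
  exists u, balanced mu A u /\ exists2 D, measurable D &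
    (forall t, `|s t - u t| <= 2 * \1_D t) /\ mass mu D <= `|integ mu s|.
Proof.
move=> mA; wlog s0 : s / 0 <= integ mu s => [th|] sA.
  have [/th|s0] := leP 0 (integ mu s); first exact.
  have bs := issign_bmeas sA.
  have [] := th (- s); [by rewrite integN// oppr_ge0 ltW|exact: issignN|].
  move=> u [bu [D mD [suD mDs]]]; exists (- u); split; first exact: balancedN.
  exists D => //; split; last by move: mDs; rewrite integN// normrN.
  by move=> t; rewrite -normrN opprB addrC; exact: suD.
have bs := issign_bmeas sA.
pose P := s @^-1` [set 1].
have mP : measurable P.
  by rewrite -[P]setTI; case: sA => ms _; exact: (ms measurableT).
have PA : P `<=` A.
  move=> t Pt; apply: contrapT => /(issign_eq0 sA) st.
  by have := oner_neq0 R; rewrite -[1]Pt st eqxx.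
have sP : integ mu s <= mass mu P.
  rewrite -integ_indic//; apply: le_integ => //; first exact: bmeas_indic.
  move=> t; rewrite indicE; have [Pt|Pt] := pselect (P t); first by rewrite mem_set// Pt.
  rewrite memNset//=; have := proj2 sA t; rewrite indicE.
  case: (_ \in _) => /eqP; last by rewrite sqrf_eq0 => /eqP ->.
  rewrite -[X in _ == X](expr1n _ 2) eqf_sqr => /orP[/eqP //|/eqP ->].
  by rewrite lerN10.
have [|D [mD DP hD]] := split_measure (c := integ mu s / 2) mP; first lra.
have bD := bmeas_indic R mD.
exists (s - 2 *: \1_D); split.
  split; last first.
    by rewrite integD ?integN ?integZ ?integ_indic ?hD//; [lra|exact: bmeasZ|exact/bmeasN/bmeasZ].
  split; first by case: (bmeasB bs (bmeasZ 2 bD)).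
  move=> t; rewrite -(proj2 sA) !fctE/= indicE.
  have [Dt|Dt] := pselect (D t); last by rewrite memNset//= scaler0 subr0.
  by rewrite mem_set//= (DP _ Dt); rewrite /GRing.scale/=; ring.
exists D => //; split; last by rewrite hD ger0_norm//; lra.
by move=> t; rewrite !fctE/= opprB addrC subrK ger0_norm// mulr_ge0// indic_ge0.
Qed.

Context (r : R) (r1 : (1 <= r%:E)%E).
Variable S : (T -> R) -> ell r1.
Hypothesis Sac : ac_linear mu S.
Variable M : R.
Hypothesis SM : forall f, bmeas f -> (forall t, `|f t| <= 1) -> `|S f| <= M.

Let r1' : 1 <= r. Proof. by rewrite -lee_fin. Qed.

(** One step of the constructions below. The first coordinates of S (g s), the
integral of g s and that of f (g s) are finitely many functionals of s, hence
they can be made small together. *)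
Lemma almost_disjoint_sign A f g x e : measurable A -> bmeas f -> bmeas g ->
  (forall t, `|g t| <= 1) -> 0 < e ->
  exists s, [/\ balanced mu A s,
    `| `|x + S (g * s)| `^ r - `|x| `^ r - `|S (g * s)| `^ r| <= e,
    `|integ mu (g * s)| <= e & `|integ mu (f * (g * s))| <= e].
Proof.
move=> mA bf bg g1 e0.
have [n [h h0 hx]] := ell_almost_disjoint x M e0.
pose phi i (u : T -> R) : R := if (i < n)%N then S (g * u) i else
  if i == n then integ mu (g * u) else integ mu (f * (g * u)).
have aphi i : ac_linear mu (phi i).
  rewrite /phi; case: (i < n)%N.
    exact: (ac_linear_mul (ac_linear_coord i Sac) bg).
  case: (i == n); first exact: ac_linear_mul integ_ac bg.
  exact: (ac_linear_mul (ac_linear_mul integ_ac bf) bg).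
have eh0 : 0 < Num.min e h by rewrite lt_min e0.
have [s bs ss] := balanced_small mu1 split_measure (n := n.+2) (fun i _ => aphi i) mA eh0.
exists s; split => //.
- apply: hx.
    apply: SM => [|t]; first exact: bmeasM bg (issign_bmeas (proj1 bs)).
    rewrite fctE normrM (issign_norm t (proj1 bs)).
    by rewrite mulr_ile1// indic_le1.
  move=> i i_n; have := ss i; rewrite /phi i_n => /(_ (leq_trans i_n (leq_trans (leqnSn _) (leqnSn _)))).
  by rewrite le_min => /andP[].
- have := ss n; rewrite /phi ltnn eqxx => /(_ (leqnSn _)).
  by rewrite le_min => /andP[].
- have := ss n.+1; rewrite /phi [(n.+1 < n)%N]ltnNge leqnSn/= gtn_eqF// => /(_ (ltnSn _)).
  by rewrite le_min => /andP[].
Qed.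

Definition running A f := A `&` [set t | `|f t| < 1].

Lemma measurable_running A f : measurable A -> bmeas f -> measurable (running A f).
Proof.
move=> mA [mf _]; apply: measurableI => //.
have : measurable_fun setT (fun t => `|f t| < 1).
  by apply: measurable_fun_ltr => //; exact: measurableT_comp.
move=> /(_ measurableT [set true]); rewrite setTI => /(_ _).
by apply.
Qed.

Lemma integ_sqrD f g : bmeas f -> bmeas g -> integ mu ((f + g) * (f + g)) =
  integ mu (f * f) + 2 * integ mu (f * g) + integ mu (g * g).
Proof.
move=> bf bg; have bff := bmeasM bf bf; have bfg := bmeasM bf bg.
have bgg := bmeasM bg bg.
have -> : (f + g) * (f + g) = f * f + 2 *: (f * g) + g * g.
  by apply/funext => t; rewrite !fctE/= /GRing.scale/=; ring.
by rewrite !integD ?integZ//; [exact: bmeasZ|apply: bmeasD => //; exact: bmeasZ].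
Qed.

(** A walk on the multiples of 1/n cannot jump over 1 or -1, so that it stays in
[-1, 1] and is exactly a sign where it has stopped. *)
Lemma lattice_step (n : nat) (z : int) (u : R) : `|u| = 1 -> (0 < n)%N ->
  `|z%:~R / n%:R : R| < 1 -> `|z%:~R / n%:R + n%:R^-1 * u : R| <= 1.
Proof.
move=> u1 n0; have n0' : 0 < n%:R :> R by rewrite ltr0n.
rewrite normrM normfV (gtr0_norm n0') ltr_pdivrMr// mul1r => zn.
have -> : z%:~R / n%:R + n%:R^-1 * u = (z%:~R + u) / n%:R by rewrite mulrDl [_^-1 * u]mulrC.
rewrite normrM normfV (gtr0_norm n0') ler_pdivrMr// mul1r (le_trans (ler_normD _ _))//.
have : `|z| + 1 <= n%:Z by rewrite lezD1 -(ltr_int R) intr_norm.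
by rewrite u1 -(ler_int R) intrD intr_norm.
Qed.

(** f is the walk after k steps, which moves by s / n on the set C where it has
not yet reached 1 or -1. Each step adds to the integral of f^2 the number
n^(-2) mass C, up to an error of 2e, because the mixed term is an integral of
f (g s); since C decreases in time this bounds the mass of the final C by the
integral of f^2. In the other direction A \ C has at most the measure
given by the integral of f^2, which is what the bounds lo and hi on the
increments of |S f|^r may rely on. *)
Lemma stopped_walk A (n : nat) (lo hi e : R) (K : nat) :
  measurable A -> (0 < n)%N -> 0 < e ->
  (forall C s, measurable C -> C `<=` A ->
     mass mu (A `\` C) <= K%:R * (n%:R^-1 ^+ 2 + 2 * e) -> balanced mu A s ->
     lo <= `|S (n%:R^-1 *: \1_C * s)| `^ r <= hi) ->
  forall k, (k <= K)%N -> exists f,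
    [/\ bmeas f, (forall t, `|f t| <= \1_A t),
        (forall t, exists z : int, f t = z%:~R / n%:R),
        `|integ mu f| <= k%:R * e &
      [/\ k%:R * (n%:R^-1 ^+ 2 * mass mu (running A f)) <= integ mu (f * f) + 2 * (k%:R * e),
        integ mu (f * f) <= k%:R * (n%:R^-1 ^+ 2 + 2 * e)
      & k%:R * (lo - e) <= `|S f| `^ r <= k%:R * (hi + e)]].
Proof.
move=> mA n0 e0 lohi; set h := n%:R^-1.
have h0 : 0 < h by rewrite invr_gt0 ltr0n.
have h1 : h <= 1 by rewrite invf_le1 ?ltr0n// ler1n.
elim=> [_|k IH kK].
  exists (0 : T -> R); have b0 : bmeas (0 : T -> R) by exact: (bmeas_cst T (0 : R)).
  have i0 : integ mu 0 = 0 by rewrite -(scale0r 0) integZ// mul0r.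
  have [_ SZ _] := Sac.
  have S0 : S 0 = 0 by rewrite -(scale0r 0) SZ// scale0r.
  split => //.
  - by move=> t; rewrite normr0 indic_ge0.
  - by move=> t; exists 0; rewrite mul0r.
  - by rewrite i0 normr0 mul0r.
  - split; rewrite ?mul0r ?mulr0 ?i0 ?addr0//.
    by rewrite S0 normr0 powR0 ?lexx// gt_eqF// (lt_le_trans ltr01).
have [f [bf fA fZ f0 [fl fu Sf]]] := IH (ltnW kK).
pose C := running A f.
have mC : measurable C by exact: measurable_running.
have CA : C `<=` A by exact: subIsetl.
have mAC : measurable (A `\` C) by exact: measurableD.
have bC := bmeas_indic R mC.
pose g : T -> R := h *: \1_C.
have bg : bmeas g by exact: bmeasZ.
have g1 t : `|g t| <= 1.
  rewrite /g fctE normrM gtr0_norm// (ger0_norm (indic_ge0 _ _)).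
  by rewrite mulr_ile1 ?indic_le1// ?indic_ge0// ltW.
have [s [bs Ss is1 is2]] := almost_disjoint_sign (S f) mA bf bg g1 e0.
have bms := issign_bmeas (proj1 bs).
have bgs := bmeasM bg bms.
have gsE t : (g * s) t = h * (\1_C t * s t) by rewrite /g !fctE /= mulrA.
have gs_in t : C t -> (g * s) t = h * s t.
  by move=> Ct; rewrite gsE indicE mem_set// mul1r.
have gs_out t : ~ C t -> (g * s) t = 0.
  by move=> Ct; rewrite gsE indicE memNset// mul0r mulr0.
(* the walk has stopped on A \ C, where f^2 = 1 *)
have AC : mass mu (A `\` C) <= integ mu (f * f).
  rewrite -integ_indic//; apply: le_integ => //; [exact: bmeas_indic|exact: bmeasM|].
  move=> t; have -> : (f * f) t = f t ^+ 2 by rewrite expr2.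
  rewrite indicE in_setD; have [At|At] := pselect (A t); last first.
    by rewrite memNset//= sqr_ge0.
  have [Ct|Ct] := pselect (C t); first by rewrite (mem_set Ct) andbF /= sqr_ge0.
  rewrite (mem_set At) (memNset Ct)/= -real_normK ?num_real//.
  by rewrite expr_ge1// leNgt; apply/negP => ft; apply: Ct.
have sq : integ mu ((g * s) * (g * s)) = h ^+ 2 * mass mu C.
  rewrite -integ_indic// -integZ//; congr integ; apply/funext => t.
  rewrite fctE; have [Ct|Ct] := pselect (C t).
    rewrite gs_in// fctE /= indicE mem_set//= /GRing.scale/= mulr1.
    have := proj2 (proj1 bs) t; rewrite indicE (mem_set (CA _ Ct)) => st.
    by rewrite -expr2 exprMn st mulr1.
  by rewrite gs_out// fctE /= indicE memNset// mulr0 scaler0.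
have sqE := integ_sqrD bf bgs; rewrite sq in sqE.
have massC1 := mass_le1 mu1 mC.
have h2 : 0 < h ^+ 2 by rewrite exprn_gt0.
exists (f + g * s).
have bf' : bmeas (f + g * s) by exact: bmeasD.
have kE : k.+1%:R = k%:R + 1 :> R by rewrite natr1.
split => //.
- move=> t; rewrite fctE; have [Ct|Ct] := pselect (C t); last by rewrite gs_out// addr0.
  have At := CA _ Ct; rewrite gs_in// indicE mem_set//=.
  have [z fz] := fZ t; move: (Ct) => [_ /=]; rewrite fz; apply: lattice_step => //.
  by rewrite (issign_norm t (proj1 bs)) indicE mem_set.
- move=> t; have [z fz] := fZ t; rewrite fctE fz.
  have [Ct|Ct] := pselect (C t); last by exists z; rewrite gs_out// addr0.
  have := proj2 (proj1 bs) t; rewrite indicE (mem_set (CA _ Ct)) => /eqP.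
  rewrite -[X in _ == X](expr1n _ 2) eqf_sqr => /orP[/eqP st|/eqP st].
    by exists (z + 1); rewrite gs_in// st intrD mulrDl mul1r mulr1.
  by exists (z - 1); rewrite gs_in// st intrD mulrDl mulrN1 rmorphN mulN1r.
- rewrite integD// (le_trans (ler_normD _ _))// kE mulrDl mul1r.
  by rewrite lerD.
have [SD _ _] := Sac.
have kee : k%:R * e + e = k.+1%:R * e by rewrite kE mulrDl mul1r.
have is2' := is2; rewrite ler_norml in is2'; case/andP: is2' => is2a is2b.
split.
- have C'C : mass mu (running A (f + g * s)) <= mass mu C.
    apply: le_mass => //; first exact: measurable_running.
    move=> t [At ft]; apply: contrapT => Ct; apply: (Ct); split => //.
    have E : (f + g * s) t = f t by rewrite fctE gs_out// addr0.
    by move: ft; rewrite /= E.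
  rewrite sqE -kee kE.
  have : (k%:R + 1) * (h ^+ 2 * mass mu (running A (f + g * s)))
      <= (k%:R + 1) * (h ^+ 2 * mass mu C).
    by rewrite ler_wpM2l ?ler_wpM2l// ?ltW// -kE ltr0n.
  move/le_trans; apply; rewrite mulrDl mul1r.
  by move: fl; rewrite -/C; lra.
- rewrite sqE kE.
  have : h ^+ 2 * mass mu C <= h ^+ 2 by rewrite ler_piMr// ltW.
  by move: fu; rewrite mulrDl mul1r; lra.
- have := lohi C s mC CA _ bs; rewrite -/h.
  have /[swap]/[apply] : mass mu (A `\` C) <= K%:R * (h ^+ 2 + 2 * e).
    rewrite (le_trans AC)// (le_trans fu)// ler_wpM2r//.
      by rewrite addr_ge0 ?ltW// mulr_gt0.
    by rewrite ler_nat ltnW.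
  move=> /andP[Sl Sh]; rewrite SD//.
  move: Ss Sf; rewrite ler_norml => /andP[? ?] /andP[? ?].
  by rewrite kE !(mulrDl k%:R 1) !mul1r; apply/andP; split; lra.
Qed.

Let M0 : 0 <= M.
Proof.
by apply: le_trans (SM (bmeas_cst T (0 : R)) _); rewrite // => t; rewrite normr0.
Qed.

Lemma powR_unbounded (a c : R) : 0 < a ->
  exists n : nat, (0 < n)%N /\ c <= n%:R `^ a.
Proof.
move=> a0; pose b := Num.max c 0 `^ a^-1.
exists (Num.truncn b).+1; split => //.
apply: (@le_trans _ _ (Num.max c 0)); first by rewrite le_max lexx.
have -> : Num.max c 0 = b `^ a.
  by rewrite -powRrM mulVf ?gt_eqF// powRr1// le_max lexx orbT.
apply: ge0_ler_powR; rewrite ?nnegrE ?powR_ge0 ?ltW//.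
exact: truncnS_gt.
Qed.

Lemma ac_linear_small e : 0 < e -> exists2 h, 0 < h & forall c D u,
  0 < c -> measurable D -> bmeas u -> (forall t, `|u t| <= c * \1_D t) ->
  mass mu D <= h -> `|S u| <= c * e.
Proof.
move=> e0; have [_ SZ /(_ e e0)[h h0 hS]] := Sac; exists h => // c D u c0 mD bu uD Dh.
have -> : u = c *: (c^-1 *: u) by rewrite scalerA divff ?gt_eqF// scale1r.
rewrite SZ; last exact: bmeasZ.
rewrite normrZ gtr0_norm//; apply: ler_wpM2l; first exact: ltW.
apply: (hS D) => //; first exact: bmeasZ.
move=> t; have -> : (c^-1 *: u) t = c^-1 * u t by [].
by rewrite normrM gtr0_norm ?invr_gt0// mulrC ler_pdivrMr// mulrC.
Qed.

Lemma norm_step_le (n : nat) C A s : measurable C -> balanced mu A s ->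
  `|S (n%:R^-1 *: \1_C * s)| `^ r <= n%:R^-1 `^ r * M `^ r.
Proof.
move=> mC bs; have bC := bmeas_indic R mC; have bms := issign_bmeas (proj1 bs).
have -> : n%:R^-1 *: \1_C * s = n%:R^-1 *: (\1_C * s).
  by apply/funext => t; rewrite !fctE/= /GRing.scale/= mulrA.
have [_ SZ _] := Sac; rewrite SZ; last exact: bmeasM.
rewrite normrZ ger0_norm ?invr_ge0// powRM// ler_wpM2l ?powR_ge0//.
apply: (powR_le_mono r1') => //.
apply: SM; first exact: bmeasM.
move=> t; rewrite fctE normrM (issign_norm t (proj1 bs)) ger0_norm ?indic_ge0//.
Qed.

(** Setting a stopped walk to 1 where it is still running makes it a sign. *)
Lemma stopped_sign A f : measurable A -> bmeas f -> (forall t, `|f t| <= \1_A t) ->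
  issign A (f + \1_(running A f) * (1 - f)).
Proof.
move=> mA bf fA; have mC := measurable_running mA bf.
have b1 : bmeas (1 : T -> R) by exact: bmeas_cst.
split.
  by case: (bmeasD bf (bmeasM (bmeas_indic R mC) (bmeasB b1 bf))).
move=> t; have -> : (f + \1_(running A f) * (1 - f)) t =
    f t + \1_(running A f) t * (1 - f t) by [].
have := fA t; rewrite !indicE; have [At|At] := pselect (A t); last first.
  by rewrite !memNset//= ?mul0r ?normr_le0 => [/eqP ->|[]//]; rewrite addr0 expr0n.
rewrite (mem_set At)/=; have [ft|ft] := ltP `|f t| 1.
  by rewrite mem_set//= mul1r addrC subrK expr1n.
rewrite memNset/=; last by move=> [_ /=]; rewrite ltNge ft.
move=> f1; rewrite mul0r addr0 -real_normK ?num_real//.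
by have -> : `|f t| = 1; [apply/eqP; rewrite eq_le f1|rewrite expr1n].
Qed.

(** The parameters are chosen in the order K, n, e: after K n^2 steps the walk
runs only on a set of measure at most 3 / K; n makes K n^2 increments of size
(M / n)^r negligible, which needs r > 2; e absorbs the errors of all steps.
Three terms remain, each at most eps / 4: S f, the completion of f to a sign,
and the balancing of that sign. *)
Lemma small_sign_gt2 A eps : 2 < r -> measurable A -> 0 < eps ->
  exists2 s, balanced mu A s & `|S s| < eps.
Proof.
move=> r2 mA eps0; have [SD SZ _] := Sac.
have [h h0 hS] := ac_linear_small (divr_gt0 eps0 (ltr0n R 8)).
pose K := (Num.truncn (8 / h)).+1.
have K0 : 0 < K%:R :> R by rewrite ltr0n.
have Kh : 8 <= K%:R * h.
  by rewrite -ler_pdivrMr// ltW// truncnS_gt.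
pose P := (eps / 4) `^ r / 2.
have P0 : 0 < P by rewrite divr_gt0// powR_gt0// divr_gt0.
have r20 : 0 < r - 2 by lra.
have [n [n0 nP]] := powR_unbounded (K%:R * M `^ r / P) r20.
have n0' : 0 < n%:R :> R by rewrite ltr0n.
pose k := (K * n ^ 2)%N.
have kE : k%:R = K%:R * n%:R ^+ 2 :> R by rewrite natrM natrX.
have k0 : 0 < k%:R :> R by rewrite kE mulr_gt0// exprn_gt0.
(* k e, the total error of the walk, is at most 1 / K and P *)
pose e := Num.min K%:R^-1 P / k%:R.
have e0 : 0 < e by rewrite divr_gt0// lt_min invr_gt0 K0.
have ke : k%:R * e = Num.min K%:R^-1 P by rewrite mulrC divfK// gt_eqF.
have keK : k%:R * e <= K%:R^-1 by rewrite ke ge_min lexx.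
have keP : k%:R * e <= P by rewrite ke ge_min lexx orbT.
have kh2 : k%:R * n%:R^-1 ^+ 2 = K%:R :> R.
  by rewrite kE exprVn mulfK// expf_neq0// gt_eqF.
have hiP : k%:R * (n%:R^-1 `^ r * M `^ r) <= P.
  have -> : n%:R^-1 `^ r = (n%:R ^+ 2)^-1 / n%:R `^ (r - 2) :> R.
    rewrite -invfM -[n%:R ^+ 2]powR_mulrn ?ltW// -powRD; last first.
      by rewrite (gt_eqF n0') implybT.
    by rewrite addrC subrK -[n%:R^-1]powR_inv1 ?ltW// -powRrM mulN1r powRN.
  rewrite kE [X in X <= _](_ : _ = K%:R * M `^ r / n%:R `^ (r - 2)); last first.
    by field; rewrite !gt_eqF// powR_gt0.
  by rewrite ler_pdivrMr ?powR_gt0// [P * _]mulrC -ler_pdivrMr.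
have [|f [bf fA _ f0 [fl _ Sf]]] := stopped_walk (lo := 0)
    (hi := n%:R^-1 `^ r * M `^ r) mA n0 e0 _ (leqnn k).
  move=> C s mC _ _ bs; rewrite powR_ge0/=.
  exact: norm_step_le mC bs.
have mC := measurable_running mA bf; set C := running A f in mC fl.
have bC := bmeas_indic R mC.
have b1 : bmeas (1 : T -> R) by exact: bmeas_cst.
have f1 t : `|f t| <= 1 by rewrite (le_trans (fA t))// indic_le1.
have ff1 : integ mu (f * f) <= 1.
  have := integ_norm_le mu1 (c := 1) measurableT (bmeasM bf bf).
  rewrite /mass mu1 mulr1 => h1; rewrite (le_trans (ler_norm _))// h1// => t.
  by rewrite fctE normrM indicE in_setT mulr1 mulr_ile1.
have Kinv1 : K%:R^-1 <= 1 :> R by rewrite invf_le1// ler1n.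
have KC : K%:R * mass mu C <= 3 by move: fl; rewrite mulrA kh2; lra.
have C3 : mass mu C <= 3 / K%:R by rewrite ler_pdivlMr// mulrC.
have K8 : 8 / K%:R <= h by rewrite ler_pdivrMr// mulrC.
(* f + u is the completed sign, and y its balanced version *)
pose u := \1_C * (1 - f); have bu : bmeas u by exact: bmeasM bC (bmeasB b1 bf).
have u2 t : `|u t| <= 2 * \1_C t.
  have -> : u t = \1_C t * (1 - f t) by [].
  rewrite normrM ger0_norm ?indic_ge0// mulrC ler_wpM2r ?indic_ge0//.
  by rewrite (le_trans (ler_normB _ _))// normr1 lerD2l.
have sx := stopped_sign mA bf fA; rewrite -/C -/u in sx.
have Kinv0 : 0 < K%:R^-1 :> R by rewrite invr_gt0.
have intx : `|integ mu (f + u)| <= h.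
  rewrite integD// (le_trans (ler_normD _ _))//.
  have := integ_norm_le mu1 mC bu u2.
  by move: K8 C3; rewrite ![_ / K%:R]mulrC; lra.
have [y [ybal [D mD [xyD Dx]]]] := balance_sign mA sx.
have bmy := issign_bmeas (proj1 ybal); have bmx := issign_bmeas sx.
exists y => //.
have -> : y = f + u + - (f + u - y) by rewrite opprB addrC subrK.
have bxy : bmeas (f + u - y) by exact: bmeasB.
rewrite SD//; last exact: bmeasN.
rewrite SD// (ac_linearN Sac)//.
have Su : `|S u| <= 2 * (eps / 8).
  by apply: (hS 2 C) => //; move: K8 C3; rewrite ![_ / K%:R]mulrC; lra.
have Sxy : `|S (f + u - y)| <= 2 * (eps / 8).
  by apply: (hS 2 D) => //; exact: le_trans Dx intx.
have Sfe : `|S f| <= eps / 4.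
  apply: (powR_le_cancel r1'); first by rewrite divr_ge0// ltW.
  case/andP: Sf => _ /le_trans; apply; rewrite mulrDr.
  have : P + P = (eps / 4) `^ r by rewrite /P; lra.
  by move=> <-; exact: lerD.
rewrite (le_lt_trans (ler_normB _ _))//.
have := ler_normD (S f) (S u); lra.
Qed.

(** The walk makes k = q i^2 steps of size 1 / (q i), so that k n^(-2) = 1 / q
bounds the measure of the set where it has stopped, up to errors. On the rest
C of A one has |S (1_C s)| >= eps / 2, because S is at most eps / 2 on the
part of s carried by a set of measure h. Then |S f|^r >= k (lo - e) grows like
i^(2 - r), while it is at most M^r. *)
Lemma small_sign_lt2 A eps : r < 2 -> measurable A -> 0 < eps ->
  exists2 s, balanced mu A s & `|S s| < eps.
Proof.
move=> r2 mA eps0; have [SD SZ _] := Sac.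
apply: contrapT => nex.
have large s : balanced mu A s -> eps <= `|S s|.
  by move=> bs; rewrite leNgt; apply/negP => Ss; apply: nex; exists s.
have e2 : 0 < eps / 2 by rewrite divr_gt0.
have [h h0 hS] := ac_linear_small e2.
pose q := (Num.truncn (2 / h)).+1.
have q0 : 0 < q%:R :> R by rewrite ltr0n.
have qh : 2 <= q%:R * h by rewrite -ler_pdivrMr// ltW// truncnS_gt.
have qh' : q%:R^-1 <= h / 2 by rewrite -div1r ler_pdivrMr//; lra.
pose a := q%:R * q%:R^-1 `^ r * (eps / 2) `^ r.
have a0 : 0 < a by rewrite !mulr_gt0// powR_gt0// invr_gt0.
have r20 : 0 < 2 - r by lra.
have [i [i0 iP]] := powR_unbounded ((2 * M `^ r + 1) / a) r20.
have i0' : 0 < i%:R :> R by rewrite ltr0n.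
pose n := (q * i)%N.
have n0 : (0 < n)%N by rewrite muln_gt0 i0.
have n0' : 0 < n%:R^-1 :> R by rewrite invr_gt0 ltr0n.
pose k := (q * i ^ 2)%N.
have kE : k%:R = q%:R * i%:R ^+ 2 :> R by rewrite natrM natrX.
have k0 : 0 < k%:R :> R by rewrite kE mulr_gt0// exprn_gt0.
have kh2 : k%:R * n%:R^-1 ^+ 2 = q%:R^-1 :> R.
  by rewrite kE natrM; field; rewrite !gt_eqF.
pose lo := n%:R^-1 `^ r * (eps / 2) `^ r.
have lo0 : 0 < lo by rewrite mulr_gt0// powR_gt0.
pose e := Num.min (h / (4 * k%:R)) (lo / 2).
have e0 : 0 < e by rewrite lt_min !divr_gt0// mulr_gt0.
have ke : k%:R * e <= h / 4.
  by rewrite mulrC -ler_pdivlMr// ge_min invfM mulrA lexx.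
have elo : e <= lo / 2 by rewrite ge_min lexx orbT.
have [|f [bf fA _ _ [_ _ /andP[Sf _]]]] :=
  stopped_walk (lo := lo) (hi := n%:R^-1 `^ r * M `^ r) mA n0 e0 _ (leqnn k).
  move=> C s mC CA ACk bs; rewrite (norm_step_le _ mC bs) andbT.
  have mAC : measurable (A `\` C) by exact: measurableD.
  have bC := bmeas_indic R mC; have bAC := bmeas_indic R mAC.
  have bms := issign_bmeas (proj1 bs).
  have -> : n%:R^-1 *: \1_C * s = n%:R^-1 *: (\1_C * s).
    by apply/funext => t; rewrite !fctE/= /GRing.scale/= mulrA.
  rewrite SZ; last exact: bmeasM.
  rewrite normrZ gtr0_norm//.
  rewrite powRM; [|exact: ltW|exact: normr_ge0].
  rewrite /lo ler_wpM2l ?powR_ge0//.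
  apply: (powR_le_mono r1'); first exact: ltW.
  have Srest : `|S (\1_(A `\` C) * s)| <= 1 * (eps / 2).
    apply: (hS 1 (A `\` C)) => //; first exact: bmeasM.
      move=> t; have -> : (\1_(A `\` C) * s) t = \1_(A `\` C) t * s t by [].
      rewrite mul1r normrM (issign_norm t (proj1 bs)) ger0_norm ?indic_ge0//.
      by rewrite ler_piMr ?indic_ge0 ?indic_le1.
    rewrite (le_trans ACk)// mulrDr kh2; lra.
  have sE : s = \1_C * s + \1_(A `\` C) * s.
    apply/funext => t; have -> : (\1_C * s + \1_(A `\` C) * s) t =
      \1_C t * s t + \1_(A `\` C) t * s t by [].
    have [At|At] := pselect (A t); last first.
      by rewrite (issign_eq0 (proj1 bs) At) !mulr0 addr0.
    rewrite !indicE in_setD (mem_set At); case: (t \in C) => /=;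
      by rewrite mul1r mul0r ?addr0 ?add0r.
  have := large s bs; rewrite {1}sE SD; try exact: bmeasM.
  have := ler_normD (S (\1_C * s)) (S (\1_(A `\` C) * s)); lra.
have SfM : `|S f| `^ r <= M `^ r.
  apply: (powR_le_mono r1') => //; apply: SM => // t.
  by rewrite (le_trans (fA t))// indic_le1.
have klo : k%:R * lo = a * i%:R `^ (2 - r).
  have nE : n%:R = q%:R * i%:R :> R by rewrite natrM.
  rewrite /lo /a kE nE invfM powRM ?invr_ge0//.
  have -> : i%:R ^+ 2 = i%:R `^ r * i%:R `^ (2 - r) :> R.
    rewrite -powRD; last by rewrite (gt_eqF i0') implybT.
    by rewrite addrC subrK powR_mulrn// ltW.
  have -> : i%:R^-1 `^ r = (i%:R `^ r)^-1 :> R.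
    by rewrite -[i%:R^-1]powR_inv1 ?ltW// -powRrM mulN1r powRN.
  by field; rewrite gt_eqF// powR_gt0.
have : 2 * M `^ r + 1 <= k%:R * lo.
  by rewrite klo [a * _]mulrC -ler_pdivrMr.
have : k%:R * (lo / 2) <= k%:R * (lo - e) by apply: ler_wpM2l; [exact: ltW|lra].
by move: Sf SfM; lra.
Qed.

(** The sign is built one piece of measure at most h at a time; on each new piece
its image is almost disjoint from what has been built, so that the r-th powers
of the norms add up and e pays for each addition. *)
Lemma small_sign_pieces b h e : 0 < h -> 0 < e ->
  (forall f B, measurable B -> bmeas f -> (forall t, `|f t| <= \1_B t) ->
     mass mu B <= h -> `|S f| `^ r <= b) ->
  forall k : nat, forall B, measurable B -> mass mu B <= k.+1%:R * h ->
  exists2 s, balanced mu B s & `|S s| `^ r <= k.+1%:R * (b + e).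
Proof.
move=> h0 e0 Sb; have [SD SZ _] := Sac.
have b1 : bmeas (1 : T -> R) by exact: bmeas_cst.
have small s B : measurable B -> balanced mu B s -> mass mu B <= h -> `|S s| `^ r <= b.
  move=> mB bs Bh; apply: (Sb _ B) => //; first exact: issign_bmeas (proj1 bs).
  exact: issign_le (proj1 bs).
have b0 : 0 <= b.
  apply: le_trans (small 0 set0 measurable0 _ _).
  - exact: powR_ge0.
  - split; last by rewrite -(scale0r (1 : T -> R)) integZ// mul0r.
    split; first exact: measurable_cst.
    by move=> t; rewrite indicE in_set0 [LHS]expr0n.
  - by rewrite /mass measure0 ltW.
elim=> [|k IH] B mB Bk.
  have [s bs] := balanced_exists mu1 split_measure mB; exists s => //.
  rewrite mul1r; rewrite mul1r in Bk.
  apply: le_trans (small s B mB bs Bk) _.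
  by rewrite lerDl ltW.
have [Bh|hB] := leP (mass mu B) h.
  have [s bs] := balanced_exists mu1 split_measure mB; exists s => //.
  apply: le_trans (small s B mB bs Bh) _; apply: (@le_trans _ _ (b + e)).
    by rewrite lerDl ltW.
  by rewrite ler_peMl ?ler1n// addr_ge0// ltW.
have [|C [mC CB hC]] := split_measure (c := h) mB; first by rewrite !ltW.
have mBC : measurable (B `\` C) by exact: measurableD.
have kE : k.+2%:R = k.+1%:R + 1 :> R by rewrite natr1.
have [|s bs Ss] := IH (B `\` C) mBC.
  by have := massD mu1 mB mC CB; rewrite hC; move: Bk; rewrite kE mulrDl; lra.
have C1 t : `|(1 : T -> R) t| <= 1 by rewrite normr1.
have [u [bu Su _ _]] := almost_disjoint_sign (S s) mC b1 b1 C1 e0.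
rewrite mul1r in Su.
exists (s + u).
  have -> : B = (B `\` C) `|` C by rewrite setUC setDUK.
  by apply: balancedU => //; rewrite setIC setDIK.
rewrite SD; [|exact: issign_bmeas (proj1 bs)|exact: issign_bmeas (proj1 bu)].
have Sub : `|S u| `^ r <= b by apply: (small u C) => //; rewrite hC.
by rewrite kE mulrDl mul1r; move: Su; rewrite ler_norml => /andP[_]; lra.
Qed.

(** With n pieces of measure 1/n the bound is n L^r n^(-r/p), up to errors: this
is where p < r enters. *)
Lemma small_sign_lt (p L : R) A eps : 0 < p -> p < r -> 0 <= L ->
  (forall f B, measurable B -> bmeas f -> (forall t, `|f t| <= \1_B t) ->
     `|S f| <= L * mass mu B `^ p^-1) ->
  measurable A -> 0 < eps ->
  exists2 s, balanced mu A s & `|S s| < eps.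
Proof.
move=> p0 pr L0 SL mA eps0.
have r0 : 0 < r by exact: lt_trans pr.
pose P := (eps / 2) `^ r / 2.
have P0 : 0 < P by rewrite divr_gt0// powR_gt0// divr_gt0.
have a0 : 0 < r / p - 1 by rewrite subr_gt0 ltr_pdivlMr// mul1r.
have [n [n0 nP]] := powR_unbounded (L `^ r / P) a0.
have n0' : 0 < n%:R :> R by rewrite ltr0n.
pose h : R := n%:R^-1; have h0 : 0 < h by rewrite invr_gt0.
have nE : n.-1.+1 = n by rewrite prednK.
have := @small_sign_pieces (L `^ r * h `^ (r / p)) h (P / n%:R) h0.
rewrite divr_gt0// => /(_ isT).
case/(_ _ n.-1 A mA).
- move=> f B mB bf fB Bh.
  have -> : L `^ r * h `^ (r / p) = (L * h `^ p^-1) `^ r.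
    by rewrite powRM ?powR_ge0// -powRrM [p^-1 * r]mulrC.
  apply: (powR_le_mono r1') => //; apply: le_trans (SL f B mB bf fB) _.
  rewrite ler_wpM2l//; apply: ge0_ler_powR => //.
  + by rewrite invr_ge0 ltW.
  + by rewrite nnegrE; exact: mass_ge0.
  + by rewrite nnegrE ltW.
- by rewrite nE /h divff ?gt_eqF//; exact: mass_le1.
move=> s bs; rewrite nE => Ss; exists s => //.
apply: (@le_lt_trans _ _ (eps / 2)); last lra.
apply: (powR_le_cancel r1'); first by rewrite divr_ge0// ltW.
rewrite (le_trans Ss)//.
have -> : (eps / 2) `^ r = P + P by rewrite /P; lra.
rewrite mulrDr lerD//; last by rewrite mulrC divfK// gt_eqF.
have -> : h `^ (r / p) = n%:R^-1 / n%:R `^ (r / p - 1).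
  rewrite -invfM -[X in (X * _)^-1]powRr1 ?ltW// -powRD; last first.
    by rewrite (gt_eqF n0') implybT.
  by rewrite addrC subrK /h -[n%:R^-1]powR_inv1 ?ltW// -powRrM mulN1r powRN.
rewrite [X in X <= _](_ : _ = L `^ r / n%:R `^ (r / p - 1)); last first.
  by field; rewrite !gt_eqF// powR_gt0.
by rewrite ler_pdivrMr ?powR_gt0// [P * _]mulrC -ler_pdivrMr.
Qed.

End small_signs.

(** * Lebesgue measure on the unit interval has no atoms *)

Section unit_interval.
Context (R : realType).
Local Notation m := (mass (mu01 R)).
Local Notation L := (lebesgue_type R).

Lemma lebesgue_type_measurable_itv (i : interval R) :
  measurable ([set` i] : set L).
Proof. apply: sub_caratheodory; exact: (measurable_itv i). Qed.

Lemma mu01_itv_le (a b : R) : a <= b ->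
  (mu01 R [set` `]a, b]] <= (b - a)%:E)%E.
Proof.
move=> ab; have mab := lebesgue_type_measurable_itv `]a, b].
apply: (@le_trans _ _ (@completed_lebesgue_measure R [set` `]a, b]])).
  apply: le_measure; rewrite ?inE//.
  by apply: measurableI => //; exact: lebesgue_measurable_itv01.
have := @lebesgue_measure_itv R `]a, b]; rewrite /= lte_fin -EFinB => h.
rewrite [leLHS](h : _ = _); case: ifPn => //.
by rewrite lee_fin subr_ge0.
Qed.

Lemma mu01_itv_out (i : interval R) : [set` i] `&` `]0, 1] = set0 ->
  mu01 R [set` i] = 0%E.
Proof.
move=> i0; apply/eqP; rewrite -measure_le0.
apply: (@le_trans _ _ (@completed_lebesgue_measure R [set` `[0, 0]])).
  apply: le_measure; rewrite ?inE//.
  - by apply: measurableI; exact: lebesgue_type_measurable_itv.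
  - exact: lebesgue_type_measurable_itv.
  - move=> t [it] /=; rewrite !in_itv/= => /andP[t0 t1].
    rewrite t0 leNgt /=; apply/negP => t0'.
    have : ([set` i] `&` `]0, 1]) t by split => //=; rewrite in_itv/= t0'.
    by rewrite i0.
have := @lebesgue_measure_itv R `[0, 0]; rewrite /= ltxx => h.
by rewrite [leLHS](h : _ = _).
Qed.

Lemma mass_itv_out (i : interval R) : [set` i] `&` `]0, 1] = set0 ->
  m [set` i] = 0.
Proof. by move=> /mu01_itv_out i0; exact: (congr1 fine i0). Qed.

(** Intermediate value theorem for t |-> mass (A /\ ]-oo, t]), which is
1-Lipschitz. *)
Lemma mu01_split (A : set L) c : measurable A -> 0 <= c <= m A ->
  exists B, [/\ measurable B, B `<=` A & m B = c].
Proof.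
move=> mA cA; have mu1 := mu01T R.
pose D t : set L := A `&` [set` `]-oo, t]].
have mD t : measurable (D t).
  by apply: measurableI => //; exact: lebesgue_type_measurable_itv.
pose F t := m (D t).
have sub s t : s <= t -> D s `<=` D t.
  move=> st x [Ax]; rewrite /= !in_itv/= => xs.
  by split => //=; rewrite in_itv/= (le_trans xs).
have lip0 s t : s <= t -> 0 <= F t - F s <= t - s.
  move=> st; rewrite /F (massD mu1 (mD t) (mD s) (sub _ _ st)) addrC addKr mass_ge0/=.
  have mst := lebesgue_type_measurable_itv `]s, t].
  apply: (@le_trans _ _ (m [set` `]s, t]])).
    apply: le_mass => //; first exact: measurableD.
    move=> x [[Ax]]; rewrite /= !in_itv/= => xt xs; rewrite xt andbT ltNge.
    by apply/negP => xs'; apply: xs; split => //=; rewrite in_itv.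
  by rewrite -lee_fin massE//; exact: mu01_itv_le.
have lip s t : `|F s - F t| <= `|s - t|.
  have [st|/ltW st] := leP s t.
    rewrite distrC [`|s - t|]distrC.
    have /andP[h1 h2] := lip0 s t st.
    by rewrite ger0_norm// ger0_norm// subr_ge0.
  have /andP[h1 h2] := lip0 t s st.
  by rewrite ger0_norm// ger0_norm// subr_ge0.
have contF : {within `[0, 1 : R], continuous F}.
  apply: continuous_subspaceT => x; apply/cvgrPdist_le => e e0.
  near=> y; apply: (le_trans (lip x y)); near: y.
  exact: (@cvgr_dist_le _ _ _ _ _ id x cvg_id e e0).
have F0 : F 0 = 0.
  apply/eqP; rewrite eq_le mass_ge0 andbT.
  have mi := lebesgue_type_measurable_itv `]-oo, 0 : R].
  rewrite (le_trans (le_mass mu1 (mD 0) mi _))//; first exact: subIsetr.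
  rewrite mass_itv_out//; apply/seteqP; split => // x [] /=.
  by rewrite !in_itv/= => x0 /andP[]; rewrite ltNge x0.
have F1 : F 1 = m A.
  have DA : D 1 `<=` A by exact: subIsetl.
  rewrite (massD mu1 mA (mD 1) DA) [X in _ = _ + X](_ : _ = 0) ?addr0//.
  apply/eqP; rewrite eq_le mass_ge0 andbT.
  have mi := lebesgue_type_measurable_itv `]1 : R, +oo[.
  apply: (@le_trans _ _ (m [set` `]1 : R, +oo[])).
    apply: le_mass => //; first exact: measurableD.
    move=> x [Ax x1]; rewrite /= in_itv/= andbT ltNge.
    by apply/negP => x1'; apply: x1; split => //=; rewrite in_itv.
  rewrite mass_itv_out//; apply/seteqP; split => // x [] /=.
  by rewrite !in_itv/= andbT => x1 /andP[_]; rewrite leNgt x1.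
have [|t _ Ft] := IVT (@ler01 R) contF (v := c).
  have mA0 : 0 <= m A by exact: mass_ge0.
  by rewrite F0 F1 (min_idPl mA0) (max_idPr mA0).
by exists (D t); split => //; exact: subIsetl.
Unshelve. all: by end_near. Qed.
End unit_interval.

(** * Classes of bounded functions in L_p *)

Section class.
Context d (T : measurableType d) (R : realType).
Variable mu : {measure set T -> \bar R}.
Hypothesis mu1 : mu setT = 1%E.
Variables (p : R) (p1 : (1 <= p%:E)%E).
Local Notation Lsp := (LspaceType mu p1).

Let p0 : 0 < p. Proof. by rewrite (@lt_le_trans _ _ 1)// -lee_fin. Qed.

Lemma Lnorm_le_mass (f : T -> R) A : measurable A -> bmeas f ->
  (forall t, `|f t| <= \1_A t) ->
  ('N[mu]_p%:E[EFin \o f] <= (mass mu A `^ p^-1)%:E)%E.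
Proof.
move=> mA [mf _] fA; rewrite unlock /Lnorm -poweR_EFin massE//.
have mN : measurable_fun setT ((fun t => poweR `|(EFin \o f) t|%E p) : T -> \bar R).
  apply: (@measurableT_comp _ _ _ _ _ _ (@poweR R ^~ p)) => //.
    exact: measurable_poweR.
  by apply: measurableT_comp => //; apply/measurable_EFinP.
have int0 : (0 <= \int[mu]_x (`|(EFin \o f) x| `^ p))%E.
  by apply: integral_ge0 => t _; exact: poweR_ge0.
apply: gt0_ler_poweR; rewrite ?invr_ge0 ?(ltW p0)// ?in_itv/= ?leey ?andbT//.
have -> : (mu A = \int[mu]_x (\1_A x)%:E)%E by rewrite integral_indic// setIT.
have mI : measurable_fun setT (EFin \o \1_A : T -> \bar R).
  by apply/measurable_EFinP; exact: measurable_indic.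
apply: ge0_le_integral => // t _.
rewrite lee_fin; have := fA t; rewrite indicE; case: (_ \in _) => /= h.
  have -> : 1 = 1 `^ p :> R by rewrite powR1.
  by apply: ge0_ler_powR; rewrite ?nnegrE// ltW.
by move: h; rewrite normr_le0 => /eqP ->; rewrite normr0 powR0// gt_eqF.
Qed.

Lemma bmeas_Lfun (f : T -> R) : bmeas f -> f \in Lfun mu p%:E.
Proof.
move=> bf; have [mf [c fc]] := bf.
pose k := Num.max c 1; have k0 : 0 < k by rewrite lt_max ltr01 orbT.
have bg : bmeas (k^-1 *: f) by exact: bmeasZ.
have gL : k^-1 *: f \in Lfun mu p%:E.
  apply/andP; split; rewrite inE/=; first by case: bg.
  apply: (le_lt_trans (Lnorm_le_mass measurableT bg _)); last by rewrite ltry.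
  move=> t; have -> : (k^-1 *: f) t = k^-1 * f t by [].
  rewrite indicE in_setT normrM gtr0_norm ?invr_gt0// mulrC ler_pdivrMr// mul1r.
  by rewrite (le_trans (fc t))// le_max lexx.
have -> : f = k \o* (k^-1 *: f).
  apply/funext => t; have -> : (k \o* (k^-1 *: f)) t = k^-1 * f t * k by [].
  by rewrite mulrAC mulVf ?mul1r// gt_eqF.
by apply: Lfun_scale => //; rewrite -lee_fin.
Qed.

(** Total, so that [fun f => T (cls f)] is an ordinary map on functions; it is
the class of f as soon as f is bounded and measurable. *)
Definition cls (f : T -> R) : Lsp :=
  if pselect (f \in Lfun mu p%:E) is left fL
  then Lspace_of (Lfun_Sub p1 fL) else 0.

Lemma cls_ae f : bmeas f -> (cls f : T -> R) = f %[ae mu].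
Proof.
move=> bf; rewrite /cls; case: pselect => [fL|/(_ (bmeas_Lfun bf))//].
exact: Lspace_ofE.
Qed.

Lemma clsD f g : bmeas f -> bmeas g -> cls (f + g) = cls f + cls g.
Proof.
move=> bf bg; apply/LspaceP; near=> t => I.
rewrite (near (cls_ae (bmeasD bf bg)) t)// (near (Lspace_addE (cls f) (cls g)) t)//.
by rewrite (near (cls_ae bf) t)// (near (cls_ae bg) t).
Unshelve. all: by end_near. Qed.

Lemma clsZ c f : bmeas f -> cls (c *: f) = c *: cls f.
Proof.
move=> bf; apply/LspaceP; near=> t => I.
rewrite (near (cls_ae (bmeasZ c bf)) t)// (near (Lspace_scaleE c (cls f)) t)//.
by rewrite (near (cls_ae bf) t).
Unshelve. all: by end_near. Qed.

Lemma norm_cls_le f A : measurable A -> bmeas f -> (forall t, `|f t| <= \1_A t) ->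
  `|cls f| <= mass mu A `^ p^-1.
Proof.
move=> mA bf fA; rewrite /cls; case: pselect => [fL|/(_ (bmeas_Lfun bf))//].
rewrite [leLHS]Lspace_norm_of -lee_fin finite_norm_fine.
exact: (Lnorm_le_mass mA bf fA).
Qed.

Lemma integral_cls f : bmeas f -> (\int[mu]_t (cls f t)%:E = (integ mu f)%:E)%E.
Proof.
move=> bf; rewrite /integ /Rintegral fineK; last first.
  exact: integrable_fin_num (bmeas_integrable mu1 bf).
apply: ae_eq_integral => //.
- by apply/measurable_EFinP; exact: measurable_ae_class.
- by apply/measurable_EFinP; case: bf.
- by apply: filterS (cls_ae bf) => t h I; rewrite h.
Qed.

End class.

(** * Narrowness of operators from L_p to l_r *)

Theorem theoremA (R : realType) (p r : R)
    (p1 : (1 <= p%:E)%E) (r1 : (1 <= r%:E)%E)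
    (hpr : r <> 2 \/ (p < 2 /\ r = 2))
    (T : {linear LspaceType (mu01 R) p1 -> ell r1})
    (T_bounded : exists M : R, forall x, `|T x| <= M * `|x|) :
  narrow T.
Proof.
move=> eps A eps0 mA _; have [M0 TM0] := T_bounded.
have mu1 := mu01T R.
pose M := Num.max M0 0.
have M_ge0 : 0 <= M by rewrite le_max lexx orbT.
have TM x : `|T x| <= M * `|x|.
  by rewrite (le_trans (TM0 x))// ler_wpM2r// le_max lexx.
have p0 : 0 < p by rewrite (@lt_le_trans _ _ 1)// -lee_fin.
pose S f := T (cls (mu01 R) p1 f).
have SL f B : measurable B -> bmeas f -> (forall t, `|f t| <= \1_B t) ->
    `|S f| <= M * mass (mu01 R) B `^ p^-1.
  move=> mB bf fB; rewrite (le_trans (TM _))// ler_wpM2l//.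
  exact: norm_cls_le.
have SM f : bmeas f -> (forall t, `|f t| <= 1) -> `|S f| <= M.
  move=> bf f1; rewrite (le_trans (SL f setT _ bf _))//.
    by move=> t; rewrite indicE in_setT.
  have -> : mass (mu01 R) setT = 1 by exact: (congr1 fine mu1).
  by rewrite powR1 mulr1.
have Sac : ac_linear (mu01 R) S.
  split.
  - by move=> f g bf bg; rewrite /S clsD// linearD.
  - by move=> c f bf; rewrite /S clsZ// linearZ.
  move=> e e0; have M1 : 0 < M + 1 by rewrite ltr_wpDl.
  exists ((e / (M + 1)) `^ p); first by rewrite powR_gt0// divr_gt0.
  move=> B f mB bf fB Bh; rewrite (le_trans (SL f B mB bf fB))//.
  have : mass (mu01 R) B `^ p^-1 <= e / (M + 1).
    have -> : e / (M + 1) = ((e / (M + 1)) `^ p) `^ p^-1.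
      by rewrite -powRrM divff ?gt_eqF// powRr1// divr_ge0// ltW.
    apply: ge0_ler_powR => //; rewrite ?nnegrE ?mass_ge0 ?powR_ge0//.
    by rewrite invr_ge0 ltW.
  rewrite ler_pdivlMr// mulrC; apply: le_trans.
  by rewrite ler_wpM2r ?powR_ge0// lerDl.
have split := @mu01_split R.
have [s [[ms s2] s0] Ss] : exists2 s, balanced (mu01 R) A s & `|S s| < eps.
  have [r2|r2|r2] := ltgtP r 2.
  - exact: (small_sign_lt2 mu1 split Sac SM r2 mA eps0).
  - exact: (small_sign_gt2 mu1 split Sac SM r2 mA eps0).
  - have pr : p < r by rewrite r2; case: hpr => [/(_ r2)//|[]].
    exact: (small_sign_lt mu1 split Sac SM p0 pr M_ge0 SL mA eps0).
have bs : bmeas s by exact: issign_bmeas (conj ms s2).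
exists (cls (mu01 R) p1 s); split => //.
- by apply: filterS (cls_ae mu1 p1 bs) => t h I; rewrite h.
- by rewrite integral_cls// s0.
Qed.
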